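(* Let $\mathfrak g$ be a graded vector space equipped with a graded anti-symmetric bracket $(\cdot,\cdot)$ of degree $0$ and a bracket $[\cdot,\cdot]$ of degree $+1$. Let $\partial_{Lie}$ and $\partial_{Leib}$ be the coderivations of $\bar Ts\bar Ss\mathfrak g$ induced by $$ss(\cdot,\cdot)(s^{-1}\otimes s^{-1})s^{-1}: s\bar S^2s\mathfrak g\to ss\mathfrak g,\qquad ss[\cdot,\cdot](s^{-1}\otimes s^{-1})(s^{-1}\otimes s^{-1}):ss\mathfrak g\otimes ss\mathfrak g\to ss\mathfrak g .$$ Then $(\mathfrak g,(\cdot,\cdot),[\cdot,\cdot])$ is a Lie-Leibniz algebra of bidegree $(0,1)$ if and only if $\partial_{LL}:=\partial_{Lie}+\partial_{Leib}$ is a codifferential of degree $-1$ on $\bar Ts\bar Ss\mathfrak g$.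
   Context: Field of characteristic zero; Koszul sign rule; $s$ is the degree $+1$ shift. A Lie-Leibniz algebra of bidegree $(0,1)$ is a graded space with a (graded) Lie bracket $(\cdot,\cdot)$ of degree $0$ and a degree $+1$ bracket $[\cdot,\cdot]$ satisfying the odd Leibniz identity $(-1)^{|x_1|}[x_1,[x_2,x_3]]+[[x_1,x_2],x_3]+(-1)^{|x_1||x_2|+|x_2|}[x_2,[x_1,x_3]]=0$ and $[x_1,(x_2,x_3)]=([x_1,x_2],x_3)+(-1)^{(|x_1|+1)|x_2|}(x_2,[x_1,x_3])$, $[(x_1,x_2),x_3]=([x_1,x_2],x_3)-(-1)^{|x_1||x_2|}([x_2,x_1],x_3)$. Bar coalgebra. $\bar SV=\bigoplus_{n\ge1}\bar S^nV$ (graded symmetric powers), $\bar TW=\bigoplus_{n\ge1}W^{\otimes n}$. Let $\Delta_c^0$ be the unshuffle coproduct of $\bar SV$ ($\Delta^0_c(v_1\cdots v_n)=\sum_{1\le i\le n-1}\sum_\sigma\varepsilon(\sigma)(v_{\sigma(1)}\cdots v_{\sigma(i)},v_{\sigma(i+1)}\cdots v_{\sigma(n)})$, $\sigma$ over $(i,n-i)$-unshuffles, $\varepsilon(\sigma)$ the Koszul sign), and on $s\bar SV$ put $\Delta_c=(s\otimes s)\Delta_c^0s^{-1}$. Write $\mathrm{unshuff}_i(w_1\cdots w_n)=\sum_\sigma\varepsilon(\sigma)(w_{\sigma(1)}\cdots w_{\sigma(i)},w_{\sigma(i+1)}\cdots w_{\sigma(n)})$ over $(i,n-i)$-unshuffles,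 and $\mathrm{unshuff}_i^{(a,b)}$ for the sub-sum with $w_a$ in the left and $w_b$ in the right word ($a=\emptyset$: no condition on the left). A $\mathcal{Z}inb\odot\mathbf{s}\mathcal{C}om$-coalgebra of bidegree $(0,1)$ is a graded space with $\Delta_z$ of degree $0$ with $(1\otimes\Delta_z)\Delta_z=(\Delta_z\otimes1)\Delta_z+(\tau\Delta_z\otimes1)\Delta_z$ ($\tau$ the graded flip) and $\Delta_c$ of degree $+1$ with $\tau\Delta_c=-\Delta_c$, $(\Delta_c\otimes1)\Delta_c=-(1\otimes\Delta_c)\Delta_c$, such that $(\Delta_z\otimes1)\Delta_c=(1\otimes\Delta_c)\Delta_z+(\Delta_c\otimes1)\Delta_z$. With $V=s\mathfrak g$, $\bar Ts\bar Ss\mathfrak g$ is the cofree (nilpotent) such coalgebra cogenerated by $ss\mathfrak g$, with $\Delta_z(sc_1\otimes\cdots\otimes sc_n)=\sum_{i=1}^{n-1}\mathrm{unshuff}_i^{(\emptyset,n)}(sc_1\otimes\cdots\otimes sc_n)$ and $\Delta_c(sc_1\otimes\cdots\otimes sc_n)=A-\tau A+B$, where $A=\sum_{k=1}^{n-1}\sum_{i=1}^{n-1}\mathrm{unshuff}_i^{(k,n)}(-1)^{|sc_1|+\cdots+|sc_{k-1}|}(sc_1\otimes\cdots\otimes\Delta_c(sc_k)\otimes\cdots\otimes sc_n)$ ($\Delta_c(sc_k)$ treated as one letter), $B=\big(\sum_{i=0}^{n-1}\mathrm{unshuff}_i(-1)^{|sc_1|+\cdots+|sc_{n-1}|}(sc_1\otimes\cdots\otimes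 sc_{n-1})\big)\otimes\Delta_c(sc_n)$ componentwise. A coderivation is an endomorphism $\partial$ with $(\partial\otimes1+1\otimes\partial)\Delta_z=\Delta_z\partial$ and $(-1)^{|\partial|}(\partial\otimes1+1\otimes\partial)\Delta_c=\Delta_c\partial$. Coderivations correspond bijectively, by projection to $ss\mathfrak g$, to linear maps $\bar Ts\bar Ss\mathfrak g\to ss\mathfrak g$; the coderivation induced by a map is the corresponding one. A codifferential is a coderivation with square zero. *)

(* Defs.v *)
From HB Require Import structures.
From mathcomp Require Import all_boot all_algebra.
From mathcomp Require Import generic_quotient ring_quotient sesquilinear.
From mathcomp Require Import boolp zify ring.
From mathcomp.multinomials Require Import freeg.

Set Implicit Arguments.
Unset Strict Implicit.
Unset Printing Implicit Defensive.

Import GRing.Theory.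
Local Open Scope ring_scope.
Local Open Scope quotient_scope.

(* A graded vector space: a vector space together with the family of its
   projections onto the homogeneous components of degree d : int. The last
   axiom says that every vector is the finite sum of its components. *)
HB.mixin Record Lmodule_isGraded (K : fieldType) V of GRing.Lmodule K V := {
  gproj : int -> V -> V;
  gproj_linear : forall d, linear (gproj d);
  gprojE : forall d e v, gproj d (gproj e v) = if d == e then gproj e v else 0;
  gproj_sum : forall v, exists2 s : seq int,
    uniq s & v = \sum_(d <- s) gproj d v
}.

#[short(type="gradedLmodType")]
HB.structure Definition GradedLmodule (K : fieldType) :=
  {V of GRing.Lmodule K V & Lmodule_isGraded K V}.

HB.instance Definition _ (K : fieldType) (V : gradedLmodType K) (d : int) :=
  GRing.isLinear.Build K V V _ (@gproj K V d) (@gproj_linear K V d).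

Definition homog (K : fieldType) (V : gradedLmodType K) (d : int) : pred V :=
  fun v => gproj d v == v.

(* Nonzero vectors have at most one degree; 0 is homogeneous of every degree,
   and the elements below remember which degree is meant. *)
Definition helt (K : fieldType) (V : gradedLmodType K) :=
  {p : int * V | homog p.1 p.2}.

Definition hdeg (K : fieldType) (V : gradedLmodType K) (x : helt V) : int :=
  (val x).1.

Definition hvec (K : fieldType) (V : gradedLmodType K) (x : helt V) : V :=
  (val x).2.

Lemma gproj_homog (K : fieldType) (V : gradedLmodType K) d (v : V) :
  homog d (gproj d v).
Proof. by rewrite /homog gprojE eqxx. Qed.

Definition hcomp (K : fieldType) (V : gradedLmodType K) (d : int) (v : V) :
  helt V := exist _ (d, gproj d v) (gproj_homog d v).

Section Presentation.
Variable K : fieldType.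

(* Graded vector spaces given by homogeneous generators and relations. *)
Record presentation := Presentation {
  gens : choiceType;
  gdeg : gens -> int;
  rel_of : {freeg gens / K} -> Prop;
  rel_homog : forall r, rel_of r ->
    exists d, forall t, coeff t r != 0 -> gdeg t = d
}.

Variable P : presentation.
Local Notation F := {freeg (gens P) / K}.

Definition relspan : {pred F} := fun x => `[< exists s : seq (K * F),
  (forall c, c \in s -> rel_of c.2) /\ x = \sum_(c <- s) c.1 *: c.2 >].

Lemma relspan_zmod_closed : zmod_closed relspan.
Proof.
split; first by apply/asboolP; exists [::]; rewrite big_nil.
move=> x y /asboolP [s [hs ->]] /asboolP [t [ht ->]]; apply/asboolP.
exists (s ++ [seq (- c.1, c.2) | c <- t]); split.
  move=> c; rewrite mem_cat => /orP [/hs //|/mapP [e /ht he ->]]; exact: he.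
rewrite big_cat big_map /= -sumrN; congr (_ + _).
by apply: eq_bigr => c _; rewrite scaleNr.
Qed.

HB.instance Definition _ :=
  GRing.isZmodClosed.Build F relspan relspan_zmod_closed.

Lemma relspanZ a x : x \in relspan -> a *: x \in relspan.
Proof.
move=> /asboolP [s [hs ->]]; apply/asboolP.
exists [seq (a * c.1, c.2) | c <- s]; split.
  by move=> c /mapP [e /hs he ->].
by rewrite big_map scaler_sumr; apply: eq_bigr => c _; rewrite scalerA.
Qed.

Lemma relspan_rel r : rel_of r -> r \in relspan.
Proof.
move=> hr; apply/asboolP; exists [:: (1, r)]; split.
  by move=> c; rewrite inE => /eqP ->.
by rewrite big_seq1 scale1r.
Qed.

Definition presented := Quotient.quot relspan.

HB.instance Definition _ := GRing.Zmodule.on presented.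
HB.instance Definition _ := EqQuotient.on presented.

Definition presented_scale (a : K) (x : presented) : presented :=
  \pi_presented (a *: repr x).

Lemma presented_eqP (x y : F) :
  (\pi_presented x = \pi_presented y) <-> (x - y \in relspan).
Proof.
by rewrite Quotient.idealrBE; split => [/eqP|/eqP].
Qed.

Lemma pi_scale a x :
  presented_scale a (\pi_presented x) = \pi_presented (a *: x).
Proof.
apply/presented_eqP; rewrite -scalerBr; apply: relspanZ.
by apply/presented_eqP; rewrite reprK.
Qed.

Lemma pi_add (x y : F) :
  \pi_presented (x + y) = (\pi_presented x + \pi_presented y : presented).
Proof. by rewrite piE. Qed.

Lemma presented_scaleA a b x :
  presented_scale a (presented_scale b x) = presented_scale (a * b) x.
Proof. by elim/quotW: x => x; rewrite (pi_scale b) !pi_scale scalerA. Qed.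

Lemma presented_scale1 x : presented_scale 1 x = x.
Proof. by elim/quotW: x => x; rewrite !pi_scale scale1r. Qed.

Lemma presented_scaleDr a x y :
  presented_scale a (x + y) = presented_scale a x + presented_scale a y.
Proof.
elim/quotW: x => x; elim/quotW: y => y.
by rewrite -pi_add !pi_scale -pi_add scalerDr.
Qed.

Lemma presented_scaleDl x a b :
  presented_scale (a + b) x = presented_scale a x + presented_scale b x.
Proof. by elim/quotW: x => x; rewrite !pi_scale -pi_add scalerDl. Qed.

HB.instance Definition _ := GRing.Zmodule_isLmodule.Build K presented
  presented_scaleA presented_scale1 presented_scaleDr presented_scaleDl.

Definition gen (t : gens P) : presented := \pi_presented << t >>.

(* The linear map determined by its values f on the generators; it is
   meaningful when f respects the relations. *)
Definition glift (M : lmodType K) (f : gens P -> M) (x : presented) : M :=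
  fglift f (repr x).

Definition respects (M : lmodType K) (f : gens P -> M) :=
  forall r, rel_of r -> fglift f r = 0.

End Presentation.
Arguments gen {K} P t.
Arguments relspan {K} P x : rename.

Section PresentationTheory.
Variable K : fieldType.

Lemma fglift_sum (T : choiceType) (M : lmodType K) (f : T -> M)
  (x : {freeg T / K}) : fglift f x = \sum_(t <- dom x) coeff t x *: f t.
Proof.
rewrite -{1}(Freeg_dom x) fglift_Freeg /prelift big_map.
by apply: eq_bigr.
Qed.

Lemma fglift_linear (T : choiceType) (M : lmodType K) (f : T -> M) :
  linear (fglift f : {freeg T / K} -> M).
Proof.
move=> a x y.
have addf (u v : {freeg T / K}) : fglift f (u + v) = fglift f u + fglift f v.
  have := lift_is_additive f u (- v); rewrite opprK => ->; congr (_ + _).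
  have := lift_is_additive f 0 v; rewrite sub0r => ->.
  have := lift_is_additive f 0 0; rewrite subrr subrr => ->.
  by rewrite sub0r opprK.
rewrite addf; congr (_ + _).
have [->|a0] := eqVneq a 0.
  rewrite !scale0r fglift_sum big_seq big1 // => t.
  by rewrite dom0.
rewrite !fglift_sum scaler_sumr (perm_big (dom x)) /=.
  by apply: eq_bigr => t _; rewrite coeffZ scalerA.
by apply: uniq_perm (uniq_dom _) (uniq_dom _) _ => t; rewrite domZ.
Qed.

HB.instance Definition _ (T : choiceType) (M : lmodType K) (f : T -> M) :=
  GRing.isLinear.Build K {freeg T / K} M _ (fglift f) (fglift_linear f).

Lemma fglift1 (T : choiceType) (M : lmodType K) (f : T -> M) t :
  fglift f (<< t >> : {freeg T / K}) = f t.
Proof. by rewrite liftU scale1r. Qed.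

Variable P : presentation K.
Local Notation F := {freeg (gens P) / K}.

Lemma respects_relspan (M : lmodType K) (f : gens P -> M) : respects f ->
  forall x : F, x \in relspan P -> fglift f x = 0.
Proof.
move=> hf x /asboolP [s [hs ->]]; rewrite linear_sum big_seq big1 // => c cs.
by rewrite linearZ /= hf ?scaler0 //; apply: hs.
Qed.

Lemma glift_pi (M : lmodType K) (f : gens P -> M) : respects f ->
  forall x : F, glift f (\pi x) = fglift f x.
Proof.
move=> hf x; apply/eqP; rewrite -subr_eq0 -linearB; apply/eqP.
apply: (respects_relspan hf).
by apply/presented_eqP; rewrite reprK.
Qed.

Lemma glift_linear (M : lmodType K) (f : gens P -> M) :
  respects f -> linear (glift f).
Proof.
move=> hf a x y; elim/quotW: x => x; elim/quotW: y => y.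
have -> : a *: \pi_(presented P) x + \pi_(presented P) y =
          \pi_(presented P) (a *: x + y).
  by rewrite pi_add -pi_scale.
by rewrite !glift_pi // linearP.
Qed.

Lemma glift_gen (M : lmodType K) (f : gens P -> M) :
  respects f -> forall t, glift f (gen P t) = f t.
Proof. by move=> hf t; rewrite /gen glift_pi // fglift1. Qed.

Lemma pi_relspan (x : F) : x \in relspan P -> \pi_(presented P) x = 0.
Proof.
move=> hx; have -> : 0 = \pi_(presented P) (0 : F) by rewrite piE.
by apply/presented_eqP; rewrite subr0.
Qed.

Lemma pi_linear : linear (\pi_(presented P) : F -> presented P).
Proof. by move=> a x y; rewrite pi_add -pi_scale. Qed.

HB.instance Definition _ := GRing.isLinear.Build K F (presented P) _
  (\pi_(presented P) : F -> presented P) pi_linear.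

Lemma pi_fglift_gen (x : F) : \pi_(presented P) x = fglift (gen P) x.
Proof.
rewrite -{1}(freeg_sumE x) fglift_sum linear_sum /=; apply: eq_bigr => t _.
have -> : << coeff t x *g t >> = coeff t x *: (<< t >> : F).
  by apply/eqP/freeg_eqP => u; rewrite coeffZ !coeffU mul1r.
by rewrite linearZ.
Qed.

Lemma presented_ind (Q : presented P -> Prop) :
  (forall a x y, Q x -> Q y -> Q (a *: x + y)) -> Q 0 ->
  (forall t, Q (gen P t)) -> forall x, Q x.
Proof.
move=> QD Q0 Qg; elim/quotW => x; rewrite pi_fglift_gen fglift_sum.
elim: (dom x) => [|t s IH]; first by rewrite big_nil.
by rewrite big_cons; apply: QD.
Qed.

(* The degree-d component keeps the generators of degree d. *)
Definition presented_proj (d : int) : presented P -> presented P :=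
  glift (fun t => if gdeg t == d then gen P t else 0).

Lemma presented_proj_respects d :
  respects (fun t : gens P => if gdeg t == d then gen P t else 0).
Proof.
move=> r hr; have [e he] := rel_homog hr; rewrite fglift_sum.
have [->|ned] := eqVneq d e.
  rewrite -[RHS](pi_relspan (relspan_rel hr)) pi_fglift_gen fglift_sum.
  rewrite big_seq [RHS]big_seq; apply: eq_bigr => t; rewrite mem_dom => /he ->.
  by rewrite eqxx.
rewrite big_seq big1 // => t; rewrite mem_dom => /he ->.
by rewrite eq_sym (negPf ned) scaler0.
Qed.

Lemma presented_proj_linear d : linear (presented_proj d).
Proof. exact: glift_linear (presented_proj_respects d). Qed.

Lemma presented_proj_gen d t :
  presented_proj d (gen P t) = if gdeg t == d then gen P t else 0.
Proof. exact: glift_gen (presented_proj_respects d) t. Qed.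

Lemma presented_proj0 d : presented_proj d 0 = 0.
Proof.
have := presented_proj_linear d (-1) 0 0.
by rewrite scaler0 addr0 scaleN1r addNr.
Qed.

Lemma presented_projE d e v :
  presented_proj d (presented_proj e v) =
  if d == e then presented_proj e v else 0.
Proof.
elim/presented_ind: v => [a x y IHx IHy||t].
- rewrite !presented_proj_linear IHx IHy.
  by case: ifP; rewrite ?scaler0 ?addr0.
- by rewrite !presented_proj0; case: ifP.
- rewrite presented_proj_gen; have [te|te] := eqVneq (gdeg t) e.
    by rewrite presented_proj_gen te eq_sym.
  by rewrite presented_proj0 if_same.
Qed.

Lemma presented_proj_sum v :
  exists2 s : seq int, uniq s & v = \sum_(d <- s) presented_proj d v.
Proof.
have wider (s s' : seq int) w : uniq s -> uniq s' -> {subset s <= s'} ->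
    w = \sum_(d <- s) presented_proj d w ->
    w = \sum_(d <- s') presented_proj d w.
  move=> us us' ss' ws; rewrite (bigID (mem s)) /= -big_filter.
  rewrite (perm_big s) /=; last first.
    apply: uniq_perm => //; first exact: filter_uniq.
    by move=> d; rewrite mem_filter; case: (boolP (d \in s)) => //= /ss' ->.
  rewrite -ws big1 ?addr0 // => d ds; rewrite {}ws.
  have linp := presented_proj_linear d.
  pose pl : {linear presented P -> presented P} :=
    HB.pack (presented_proj d) (GRing.isLinear.Build _ _ _ _ _ linp).
  rewrite -[presented_proj d]/(pl : _ -> _) linear_sum big_seq big1 // => e es.
  rewrite /= presented_projE; case: eqP => // de.
  by rewrite de es in ds.
elim/presented_ind: v => [a x y [s us hs] [t ut ht]||t].
- exists (undup (s ++ t)); first exact: undup_uniq.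
  under eq_bigr do rewrite presented_proj_linear.
  rewrite big_split -scaler_sumr /=; congr (a *: _ + _).
    apply: wider us (undup_uniq _) _ hs => d.
    by rewrite mem_undup mem_cat => ->.
  apply: wider ut (undup_uniq _) _ ht => d.
  by rewrite mem_undup mem_cat orbC => ->.
- by exists [::]; rewrite ?big_nil.
- by exists [:: gdeg t]; rewrite // big_seq1 presented_proj_gen eqxx.
Qed.

HB.instance Definition _ := Lmodule_isGraded.Build K (presented P)
  presented_proj_linear presented_projE presented_proj_sum.

Lemma gen_homog t : homog (gdeg t) (gen P t).
Proof. by rewrite /homog /gproj /= presented_proj_gen eqxx. Qed.

Definition hgen (t : gens P) : helt (presented P) :=
  exist _ (gdeg t, gen P t) (gen_homog t).

End PresentationTheory.
Arguments hgen {K} P t.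

Definition ksign (K : fieldType) (n : int) : K := (-1) ^ n.

Section Tensor.
Variables (K : fieldType) (V W : gradedLmodType K).

Inductive tensor_rel : {freeg (helt V * helt W)%type / K} -> Prop :=
| TensorLinl a x y z w :
    hdeg x = hdeg z -> hdeg y = hdeg z -> hvec z = a *: hvec x + hvec y ->
    tensor_rel (<< (z, w) >> - a *: << (x, w) >> - << (y, w) >>)
| TensorLinr a x y z v :
    hdeg x = hdeg z -> hdeg y = hdeg z -> hvec z = a *: hvec x + hvec y ->
    tensor_rel (<< (v, z) >> - a *: << (v, x) >> - << (v, y) >>).

Definition tensor_deg (p : helt V * helt W) : int := hdeg p.1 + hdeg p.2.

Lemma tensor_rel_homog r : tensor_rel r ->
  exists d, forall t, coeff t r != 0 -> tensor_deg t = d.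
Proof.
case=> a x y z w xz yz _; [exists (hdeg z + hdeg w)|exists (hdeg w + hdeg z)];
  move=> t; rewrite !coeffB coeffZ !coeffU !mul1r /tensor_deg;
  (case: (_ =P t) => [<- //|_]; case: (_ =P t) => [<- /=|_]; first by rewrite xz);
  (case: (_ =P t) => [<- /=|_]; first by rewrite yz);
  by rewrite !mulr0n mulr0 !subr0 eqxx.
Qed.

Definition tensor_pres := @Presentation K (helt V * helt W)%type tensor_deg
  tensor_rel tensor_rel_homog.

Definition tensor := presented tensor_pres.
HB.instance Definition _ := GradedLmodule.on tensor.

Definition tens (v : helt V) (w : helt W) : tensor := gen tensor_pres (v, w).

End Tensor.

Section Words.
Variables (K : fieldType) (V : gradedLmodType K).
Local Notation word := (seq (helt V)).

Definition word_deg (w : word) : int := \sum_(x <- w) hdeg x.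

(* The empty word is set to zero, so that words span the sum over n >= 1. *)
Inductive tbar_rel : {freeg word / K} -> Prop :=
| TbarNil : tbar_rel << [::] >>
| TbarLin a u x y z v :
    hdeg x = hdeg z -> hdeg y = hdeg z -> hvec z = a *: hvec x + hvec y ->
    tbar_rel (<< u ++ z :: v >> - a *: << u ++ x :: v >> - << u ++ y :: v >>).

(* In characteristic 0 the last relation kills the squares of odd letters. *)
Inductive sbar_rel : {freeg word / K} -> Prop :=
| SbarTbar r : tbar_rel r -> sbar_rel r
| SbarSym u x y v :
    sbar_rel (<< u ++ x :: y :: v >>
              - ksign K (hdeg x * hdeg y) *: << u ++ y :: x :: v >>).

Lemma tbar_rel_homog r : tbar_rel r ->
  exists d, forall t, coeff t r != 0 -> word_deg t = d.
Proof.
case=> [|a u x y z v xz yz _].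
  exists (word_deg [::]) => t; rewrite coeffU mul1r.
  by case: (_ =P t) => [<- //|_]; rewrite mulr0n eqxx.
exists (word_deg (u ++ z :: v)) => t; rewrite !coeffB coeffZ !coeffU !mul1r.
case: (_ =P t) => [<- //|_]; case: (_ =P t) => [<- _|_].
  by rewrite /word_deg !big_cat !big_cons /= xz.
case: (_ =P t) => [<- _|_]; first by rewrite /word_deg !big_cat !big_cons /= yz.
by rewrite !mulr0n mulr0 !subr0 eqxx.
Qed.

Lemma sbar_rel_homog r : sbar_rel r ->
  exists d, forall t, coeff t r != 0 -> word_deg t = d.
Proof.
case=> [{}r /tbar_rel_homog //|u x y v].
exists (word_deg (u ++ x :: y :: v)) => t; rewrite !coeffB coeffZ !coeffU !mul1r.
case: (_ =P t) => [<- //|_]; case: (_ =P t) => [<- _|_].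
  by rewrite /word_deg !big_cat !big_cons /= [X in _ + X]addrCA.
by rewrite !mulr0n mulr0 !subr0 eqxx.
Qed.

Definition tbar_pres := @Presentation K word word_deg tbar_rel tbar_rel_homog.
Definition sbar_pres := @Presentation K word word_deg sbar_rel sbar_rel_homog.

Definition Tbar := presented tbar_pres.
Definition Sbar := presented sbar_pres.
HB.instance Definition _ := GradedLmodule.on Tbar.
HB.instance Definition _ := GradedLmodule.on Sbar.

Definition tword (w : word) : helt Tbar := hgen tbar_pres w.
Definition sword (w : word) : helt Sbar := hgen sbar_pres w.

(* The projections onto the summands with n = 1. *)
Definition tproj : Tbar -> V := @glift K tbar_pres V
  (fun w => if w is [:: x] then hvec x else 0).
Definition sproj : Sbar -> V := @glift K sbar_pres V
  (fun w => if w is [:: x] then hvec x else 0).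

End Words.

(* The shift of degree +1: a copy of V with degrees raised by 1. *)
Section Shift.
Variables (K : fieldType) (V : gradedLmodType K).

Record shift : Type := sh { unsh : V }.

HB.instance Definition _ := [isNew for unsh].
HB.instance Definition _ := [Choice of shift by <:].

Definition shift_zero : shift := sh 0.
Definition shift_opp (x : shift) : shift := sh (- unsh x).
Definition shift_add (x y : shift) : shift := sh (unsh x + unsh y).
Definition shift_scale (a : K) (x : shift) : shift := sh (a *: unsh x).

Lemma shift_addA : associative shift_add.
Proof. by move=> x y z; rewrite /shift_add addrA. Qed.
Lemma shift_addC : commutative shift_add.
Proof. by move=> x y; rewrite /shift_add addrC. Qed.
Lemma shift_add0 : left_id shift_zero shift_add.
Proof. by case=> x; rewrite /shift_add add0r. Qed.
Lemma shift_addN : left_inverse shift_zero shift_opp shift_add.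
Proof. by case=> x; rewrite /shift_add addNr. Qed.

HB.instance Definition _ := GRing.isZmodule.Build shift
  shift_addA shift_addC shift_add0 shift_addN.

Lemma shift_scaleA a b x :
  shift_scale a (shift_scale b x) = shift_scale (a * b) x.
Proof. by rewrite /shift_scale scalerA. Qed.
Lemma shift_scale1 : left_id 1 shift_scale.
Proof. by case=> x; rewrite /shift_scale scale1r. Qed.
Lemma shift_scaleDr : right_distributive shift_scale +%R.
Proof. by move=> a x y; rewrite /shift_scale scalerDr. Qed.
Lemma shift_scaleDl x : {morph shift_scale^~ x : a b / a + b}.
Proof. by move=> a b; rewrite /shift_scale scalerDl. Qed.

HB.instance Definition _ := GRing.Zmodule_isLmodule.Build K shift
  shift_scaleA shift_scale1 shift_scaleDr shift_scaleDl.

Lemma sh_linear : linear sh. Proof. by []. Qed.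
Lemma unsh_linear : linear unsh. Proof. by []. Qed.
HB.instance Definition _ := GRing.isLinear.Build K V shift _ sh sh_linear.
HB.instance Definition _ := GRing.isLinear.Build K shift V _ unsh unsh_linear.

Definition shift_proj (d : int) (v : shift) : shift := sh (gproj (d - 1) (unsh v)).

Lemma shift_proj_linear d : linear (shift_proj d).
Proof. by move=> a x y; rewrite /shift_proj !linearP. Qed.

Lemma shift_projE d e v :
  shift_proj d (shift_proj e v) = if d == e then shift_proj e v else 0.
Proof. by rewrite /shift_proj /= gprojE (inj_eq (addIr _)); case: eqP. Qed.

Lemma shift_proj_sum v :
  exists2 s : seq int, uniq s & v = \sum_(d <- s) shift_proj d v.
Proof.
have [s us hs] := gproj_sum (unsh v); exists [seq d + 1 | d <- s].
  by rewrite map_inj_uniq // => d e /addIr.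
rewrite big_map; case: v hs => v /= {1}->; rewrite linear_sum /=.
by apply: eq_bigr => d _; rewrite /shift_proj addrK.
Qed.

HB.instance Definition _ := Lmodule_isGraded.Build K shift
  shift_proj_linear shift_projE shift_proj_sum.

End Shift.

(* (f (x) g)(x (x) y) = (-1)^(|g||x|) f x (x) g y for f and g linear of degrees
   kf and kg; then f x and g y are homogeneous and hcomp leaves them alone. *)
Definition tens_map (K : fieldType) (V W V' W' : gradedLmodType K)
    (kf kg : int) (f : V -> V') (g : W -> W') : tensor V W -> tensor V' W' :=
  @glift K (tensor_pres V W) (tensor V' W') (fun p =>
    ksign K (kg * hdeg p.1) *:
      tens (hcomp (hdeg p.1 + kf) (f (hvec p.1)))
           (hcomp (hdeg p.2 + kg) (g (hvec p.2)))).

Definition flip (K : fieldType) (V W : gradedLmodType K) :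
    tensor V W -> tensor W V :=
  @glift K (tensor_pres V W) (tensor W V) (fun p =>
    ksign K (hdeg p.1 * hdeg p.2) *: tens p.2 p.1).

(* The linear map on V (x) V induced by a bilinear one. *)
Definition tens_eval (K : fieldType) (V : gradedLmodType K) (U : lmodType K)
    (b : V -> V -> U) : tensor V V -> U :=
  @glift K (tensor_pres V V) U (fun p => b (hvec p.1) (hvec p.2)).

(* An (i, n - i)-unshuffle is encoded by the bit mask of length n with i bits
   set that marks the positions sent to the left word. *)
Fixpoint masks (n : nat) : seq bitseq :=
  if n is m.+1 then map (cons true) (masks m) ++ map (cons false) (masks m)
  else [:: [::]].

Definition rmask (T : Type) (b : bitseq) (w : seq T) := mask (map negb b) w.

(* The exponent of the Koszul sign: a letter sent to the right contributes its
   degree times those of the later letters sent to the left. *)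
Fixpoint kexp (ds : seq int) (b : bitseq) : int :=
  match ds, b with
  | d :: ds', c :: b' =>
      (if c then 0 else d * \sum_(e <- mask b' ds') e) + kexp ds' b'
  | _, _ => 0
  end.

(* The sum of eps(sigma) F(sigma) over the (i, n - i)-unshuffles sigma of
   letters of degrees ds that satisfy Q. *)
Definition unshuff (K : fieldType) (M : lmodType K) (i : nat)
    (Q : pred bitseq) (ds : seq int) (F : bitseq -> M) : M :=
  \sum_(b <- masks (size ds) | (count id b == i) && Q b)
    ksign K (kexp ds b) *: F b.

Section Coproducts.
Variables (K : fieldType) (V : gradedLmodType K).

Definition degs (w : seq (helt V)) : seq int := map (@hdeg K V) w.

Definition scop0 : Sbar V -> tensor (Sbar V) (Sbar V) :=
  @glift K (sbar_pres V) _ (fun w =>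
    \sum_(1 <= i < size w) unshuff i xpredT (degs w) (fun b =>
      tens (sword (mask b w)) (sword (rmask b w)))).

Definition scop (x : shift (Sbar V)) :
    tensor (shift (Sbar V)) (shift (Sbar V)) :=
  tens_map 1 1 (@sh K (Sbar V)) (@sh K (Sbar V)) (scop0 (unsh x)).

(* Bits are numbered from 0, so n.-1 is the last letter. *)
Definition zcop : Tbar V -> tensor (Tbar V) (Tbar V) :=
  @glift K (tbar_pres V) _ (fun w =>
    let n := size w in
    \sum_(1 <= i < n)
      unshuff i (fun b => ~~ nth true b n.-1) (degs w) (fun b =>
        tens (tword (mask b w)) (tword (rmask b w)))).

Variable cop : V -> tensor V V.

(* Replacing the letter w_k by the two letters of cop w_k; k and the last
   position n.-1 are sent to the left and to the right respectively. As a single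
   letter, cop w_k has degree |w_k| + 1. *)
Definition ccopA (w : seq (helt V)) : tensor (Tbar V) (Tbar V) :=
  let n := size w in
  \sum_(0 <= k < n.-1) \sum_(1 <= i < n)
    unshuff i (fun b => nth false b k && ~~ nth true b n.-1)
      (set_nth 0 (degs w) k (nth 0 (degs w) k + 1)) (fun b =>
        ksign K (word_deg (take k w)) *:
        @glift K (tensor_pres V V) (tensor (Tbar V) (Tbar V)) (fun p =>
          tens (tword (mask (take k b) (take k w) ++ [:: p.1; p.2] ++
                       mask (drop k.+1 b) (drop k.+1 w)))
               (tword (rmask b w)))
          (cop (hvec (nth (hcomp 0 0) w k)))).

(* The inner sign moves the first tensor factor p.1 past the right word. *)
Definition ccopB (w : seq (helt V)) : tensor (Tbar V) (Tbar V) :=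
  if w is x :: w' then
    let u := belast x w' in
    \sum_(0 <= i < size w)
      unshuff i xpredT (degs u) (fun b =>
        ksign K (word_deg u) *:
        @glift K (tensor_pres V V) (tensor (Tbar V) (Tbar V)) (fun p =>
          ksign K (word_deg (rmask b u) * hdeg p.1) *:
          tens (tword (rcons (mask b u) p.1)) (tword (rcons (rmask b u) p.2)))
          (cop (hvec (last x w'))))
  else 0.

Definition ccop : Tbar V -> tensor (Tbar V) (Tbar V) :=
  @glift K (tbar_pres V) _ (fun w => ccopA w - flip (ccopA w) + ccopB w).

End Coproducts.

Section LieLeibniz.
Variables (K : fieldType) (g : gradedLmodType K).
Implicit Types (br lie leib : g -> g -> g).

Definition bracket_degree (k : int) br := forall i j x y,
  homog i x -> homog j y -> homog (i + j + k) (br x y).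

Definition graded_antisymmetric br := forall i j x y,
  homog i x -> homog j y -> br x y = - (ksign K (i * j) *: br y x).

Definition graded_jacobi br := forall i j k x y z,
  homog i x -> homog j y -> homog k z ->
  br x (br y z) = br (br x y) z + ksign K (i * j) *: br y (br x z).

Definition odd_leibniz br := forall i j k x y z,
  homog i x -> homog j y -> homog k z ->
  ksign K i *: br x (br y z) + br (br x y) z
    + ksign K (i * j + j) *: br y (br x z) = 0.

Record Lie_Leibniz_algebra lie leib : Prop := {
  lie_degree : bracket_degree 0 lie;
  lie_antisymmetric : graded_antisymmetric lie;
  lie_jacobi : graded_jacobi lie;
  leib_degree : bracket_degree 1 leib;
  leib_leibniz : odd_leibniz leib;
  leib_lie : forall i j k x y z,
    homog i x -> homog j y -> homog k z ->
    leib x (lie y z)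
      = lie (leib x y) z + ksign K ((i + 1) * j) *: lie y (leib x z);
  lie_leib : forall i j k x y z,
    homog i x -> homog j y -> homog k z ->
    leib (lie x y) z
      = lie (leib x y) z - ksign K (i * j) *: lie (leib y x) z
}.

Definition bar := Tbar (shift (Sbar (shift g))).
HB.instance Definition _ := GradedLmodule.on bar.

Definition bar_zcop : bar -> tensor bar bar :=
  @zcop K (shift (Sbar (shift g))).
Definition bar_ccop : bar -> tensor bar bar :=
  ccop (@scop K (shift g)).

(* The degree 0 projection of s Sbar s g onto s s g. *)
Definition letter_proj (c : shift (Sbar (shift g))) : shift (shift g) :=
  sh (sproj (unsh c)).

Definition bar_proj (x : bar) : shift (shift g) := letter_proj (tproj x).

(* D (x) 1 + 1 (x) D, for D of degree k *)
Definition tens_deriv (k : int) (D : bar -> bar) (t : tensor bar bar) :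
    tensor bar bar :=
  tens_map k 0 D id t + tens_map 0 k id D t.

Record coderivation (k : int) (D : bar -> bar) : Prop := {
  coder_linear : linear D;
  coder_degree : forall d x, homog d x -> homog (d + k) (D x);
  coder_zcop : forall x, tens_deriv k D (bar_zcop x) = bar_zcop (D x);
  coder_ccop : forall x,
    ksign K k *: tens_deriv k D (bar_ccop x) = bar_ccop (D x)
}.

Definition codifferential (k : int) (D : bar -> bar) : Prop :=
  coderivation k D /\ forall x, D (D x) = 0.

Definition desuspend2 (V : gradedLmodType K) :
    tensor (shift V) (shift V) -> tensor V V :=
  tens_map (-1) (-1) (@unsh K V) (@unsh K V).

(* ss lie (s^-1 (x) s^-1) s^-1 on s Sbar^2 s g, and zero on the other s Sbar^n
   and on the words with more than one letter *)
Definition lie_corestriction lie (x : bar) : shift (shift g) :=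
  @glift K (sbar_pres (shift g)) (shift (shift g)) (fun w =>
    if w is [:: a; b] then sh (sh (tens_eval lie (desuspend2 (tens a b))))
    else 0) (unsh (tproj x)).

(* ss leib (s^-1 (x) s^-1)(s^-1 (x) s^-1) on ssg (x) ssg, and zero on the
   other summands; letter_proj kills the letters outside ssg *)
Definition leib_corestriction leib (x : bar) : shift (shift g) :=
  @glift K (tbar_pres (shift (Sbar (shift g)))) (shift (shift g)) (fun w =>
    if w is [:: c1; c2] then
      sh (sh (tens_eval leib (@desuspend2 g (@desuspend2 (shift g)
        (tens_map 0 0 letter_proj letter_proj (tens c1 c2))))))
    else 0) x.

(* By cofreeness each f of degree k is the projection of exactly one D. *)
Definition induced_coderivation (k : int) (f : bar -> shift (shift g))
    (D : bar -> bar) : Prop :=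
  coderivation k D /\ forall x, bar_proj (D x) = f x.

End LieLeibniz.

(* The functions on generators used above respect the relations, so that every
   glift above is the linear map with the stated values. *)
Section WellDefined.
Variable K : fieldType.
Implicit Types (V W : gradedLmodType K) (M : lmodType K).

Definition multilinear V M (f : seq (helt V) -> M) :=
  forall a u x y z v,
    hdeg x = hdeg z -> hdeg y = hdeg z -> hvec z = a *: hvec x + hvec y ->
    f (u ++ z :: v) = a *: f (u ++ x :: v) + f (u ++ y :: v).

Lemma tbar_respects V M (f : seq (helt V) -> M) :
  f [::] = 0 -> multilinear f -> @respects K (tbar_pres V) M f.
Proof.
move=> f0 fm r [|a u x y z v xz yz zE]; first by rewrite fglift1.
by rewrite !linearB linearZ /= !fglift1 (fm a u x y z v) // -addrA -opprD subrr.
Qed.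

Lemma sbar_respects V M (f : seq (helt V) -> M) :
  f [::] = 0 -> multilinear f ->
  (forall u x y v, f (u ++ x :: y :: v)
     = ksign K (hdeg x * hdeg y) *: f (u ++ y :: x :: v)) ->
  @respects K (sbar_pres V) M f.
Proof.
move=> f0 fm fs r [{}r hr|u x y v]; first exact: (tbar_respects f0 fm hr).
by rewrite linearB linearZ /= !fglift1 fs subrr.
Qed.

Lemma tensor_respects V W M (f : helt V -> helt W -> M) :
  (forall a x y z w,
     hdeg x = hdeg z -> hdeg y = hdeg z -> hvec z = a *: hvec x + hvec y ->
     f z w = a *: f x w + f y w) ->
  (forall a x y z v,
     hdeg x = hdeg z -> hdeg y = hdeg z -> hvec z = a *: hvec x + hvec y ->
     f v z = a *: f v x + f v y) ->
  @respects K (tensor_pres V W) M (fun p => f p.1 p.2).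
Proof.
move=> fl fr r [a x y z w xz yz zE|a x y z v xz yz zE];
  rewrite !linearB linearZ /= !fglift1 /=.
  by rewrite (fl a x y z w) // -addrA -opprD subrr.
by rewrite (fr a x y z v) // -addrA -opprD subrr.
Qed.

Lemma presented_lin (P : presentation K) a (x y z : gens P) :
  rel_of (<< z >> - a *: << x >> - << y >>) ->
  gen P z = a *: gen P x + gen P y.
Proof.
move=> /relspan_rel/pi_relspan/eqP; rewrite !linearB linearZ /= -addrA -opprD.
by rewrite subr_eq0 => /eqP.
Qed.

Lemma tens_linl V W a (x y z : helt V) (w : helt W) :
  hdeg x = hdeg z -> hdeg y = hdeg z -> hvec z = a *: hvec x + hvec y ->
  tens z w = a *: tens x w + tens y w.
Proof. by move=> xz yz zE; apply: presented_lin; apply: TensorLinl. Qed.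

Lemma tens_linr V W a (x y z : helt W) (v : helt V) :
  hdeg x = hdeg z -> hdeg y = hdeg z -> hvec z = a *: hvec x + hvec y ->
  tens v z = a *: tens v x + tens v y.
Proof. by move=> xz yz zE; apply: presented_lin; apply: TensorLinr. Qed.

Lemma tens0l V W (v : helt V) (w : helt W) : hvec v = 0 -> tens v w = 0.
Proof.
move=> v0; rewrite (@tens_linl _ _ (-1) v v v w) // ?v0 ?scaler0 ?addr0 //.
by rewrite scaleN1r addNr.
Qed.

Lemma tens0r V W (v : helt V) (w : helt W) : hvec w = 0 -> tens v w = 0.
Proof.
move=> w0; rewrite (@tens_linr _ _ (-1) w w w v) // ?w0 ?scaler0 ?addr0 //.
by rewrite scaleN1r addNr.
Qed.

Lemma hdeg_hcomp V d (v : V) : hdeg (hcomp d v) = d.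
Proof. by []. Qed.

Lemma hvec_hcomp V d (v : V) : hvec (hcomp d v) = gproj d v.
Proof. by []. Qed.

Lemma tens_scalel V W a (x z : helt V) (w : helt W) :
  hdeg x = hdeg z -> hvec z = a *: hvec x -> tens z w = a *: tens x w.
Proof.
move=> xz zE; rewrite (@tens_linl _ _ a x (hcomp (hdeg z) 0)) //.
  by rewrite [tens (hcomp _ _) w]tens0l ?addr0 ?hvec_hcomp ?raddf0 //.
by rewrite hvec_hcomp raddf0 addr0.
Qed.

Lemma tens_scaler V W a (x z : helt W) (v : helt V) :
  hdeg x = hdeg z -> hvec z = a *: hvec x -> tens v z = a *: tens v x.
Proof.
move=> xz zE; rewrite (@tens_linr _ _ a x (hcomp (hdeg z) 0)) //.
  by rewrite [tens v (hcomp _ _)]tens0r ?addr0 ?hvec_hcomp ?raddf0 //.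
by rewrite hvec_hcomp raddf0 addr0.
Qed.

Lemma tens_respects V W :
  @respects K (tensor_pres V W) _ (fun p => tens p.1 p.2).
Proof.
apply: (tensor_respects (f := fun x y => tens x y)) => a x y z w;
  [exact: tens_linl | exact: tens_linr].
Qed.

Lemma tens_map_respects V W V' W' kf kg (f : {linear V -> V'})
    (g : {linear W -> W'}) :
  @respects K (tensor_pres V W) (tensor V' W') (fun p =>
    ksign K (kg * hdeg p.1) *:
      tens (hcomp (hdeg p.1 + kf) (f (hvec p.1)))
           (hcomp (hdeg p.2 + kg) (g (hvec p.2)))).
Proof.
apply: (tensor_respects (f := fun x y => ksign K (kg * hdeg x) *:
  tens (hcomp (hdeg x + kf) (f (hvec x))) (hcomp (hdeg y + kg) (g (hvec y)))))
  => a x y z w xz yz zE.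
  rewrite (@tens_linl _ _ a (hcomp (hdeg x + kf) (f (hvec x)))
    (hcomp (hdeg y + kf) (f (hvec y)))); first last.
  - by rewrite !hvec_hcomp zE !linearP xz yz.
  - by rewrite !hdeg_hcomp yz.
  - by rewrite !hdeg_hcomp xz.
  by rewrite scalerDr !scalerA xz yz mulrC.
rewrite (@tens_linr _ _ a (hcomp (hdeg x + kg) (g (hvec x)))
  (hcomp (hdeg y + kg) (g (hvec y)))); first last.
- by rewrite !hvec_hcomp zE !linearP xz yz.
- by rewrite !hdeg_hcomp yz.
- by rewrite !hdeg_hcomp xz.
by rewrite scalerDr !scalerA mulrC.
Qed.

Lemma tens_map_linear V W V' W' kf kg (f : V -> V') (g : W -> W') :
  linear f -> linear g -> linear (tens_map kf kg f g).
Proof.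
move=> fl gl.
pose f' : {linear V -> V'} := HB.pack f (GRing.isLinear.Build _ _ _ _ _ fl).
pose g' : {linear W -> W'} := HB.pack g (GRing.isLinear.Build _ _ _ _ _ gl).
exact: (glift_linear (tens_map_respects kf kg f' g')).
Qed.

Lemma tens_map_tens V W V' W' kf kg (f : V -> V') (g : W -> W') x y :
  linear f -> linear g ->
  tens_map kf kg f g (tens x y) = ksign K (kg * hdeg x) *:
    tens (hcomp (hdeg x + kf) (f (hvec x))) (hcomp (hdeg y + kg) (g (hvec y))).
Proof.
move=> fl gl.
pose f' : {linear V -> V'} := HB.pack f (GRing.isLinear.Build _ _ _ _ _ fl).
pose g' : {linear W -> W'} := HB.pack g (GRing.isLinear.Build _ _ _ _ _ gl).
exact: (glift_gen (tens_map_respects kf kg f' g')).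
Qed.

Lemma flip_respects V W :
  @respects K (tensor_pres V W) (tensor W V) (fun p =>
    ksign K (hdeg p.1 * hdeg p.2) *: tens p.2 p.1).
Proof.
apply: (tensor_respects (f := fun x y => ksign K (hdeg x * hdeg y) *: tens y x))
  => a x y z w xz yz zE.
  by rewrite (tens_linr _ xz yz zE) scalerDr !scalerA xz yz mulrC.
by rewrite (tens_linl _ xz yz zE) scalerDr !scalerA xz yz mulrC.
Qed.

Lemma tens_eval_respects V M (b : {bilinear V -> V -> M}) :
  @respects K (tensor_pres V V) M (fun p => b (hvec p.1) (hvec p.2)).
Proof.
apply: (tensor_respects (f := fun x y => b (hvec x) (hvec y))) => a x y z w _ _ ->.
  by rewrite linearPl.
by rewrite linearPr.
Qed.

Lemma proj_multilinear V :
  multilinear (fun w : seq (helt V) => if w is [:: x] then hvec x else 0).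
Proof.
move=> a [|t [|t' u]] x y z v _ _ zE /=; last 2 first.
- by rewrite scaler0 addr0.
- by rewrite scaler0 addr0.
by case: v => [|? ?]; rewrite ?zE // scaler0 addr0.
Qed.

Lemma tproj_respects V : @respects K (tbar_pres V) V
  (fun w => if w is [:: x] then hvec x else 0).
Proof. exact: tbar_respects (@proj_multilinear V). Qed.

Lemma sproj_respects V : @respects K (sbar_pres V) V
  (fun w => if w is [:: x] then hvec x else 0).
Proof.
apply: sbar_respects (@proj_multilinear V) _ => // u x y v.
by case: u => [|? [|? ?]] /=; rewrite scaler0.
Qed.

Lemma word_deg_cat V (u v : seq (helt V)) :
  word_deg (u ++ v) = word_deg u + word_deg v.
Proof. by rewrite /word_deg big_cat. Qed.

Lemma word_deg_cons V x (v : seq (helt V)) :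
  word_deg (x :: v) = hdeg x + word_deg v.
Proof. by rewrite /word_deg big_cons. Qed.

Lemma hdeg_tword V (w : seq (helt V)) : hdeg (tword w) = word_deg w.
Proof. by []. Qed.

Lemma hdeg_sword V (w : seq (helt V)) : hdeg (sword w) = word_deg w.
Proof. by []. Qed.

Lemma tword0 V : hvec (tword [::] : helt (Tbar V)) = 0.
Proof. by apply: pi_relspan; apply: relspan_rel; apply: TbarNil. Qed.

Lemma sword0 V : hvec (sword [::] : helt (Sbar V)) = 0.
Proof.
by apply: pi_relspan; apply: relspan_rel; apply: SbarTbar; apply: TbarNil.
Qed.

Lemma tword_multilinear V : multilinear (fun w : seq (helt V) => hvec (tword w)).
Proof.
move=> a u x y z v xz yz zE; apply: (@presented_lin (tbar_pres V)).
exact: TbarLin.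
Qed.

Lemma sword_multilinear V : multilinear (fun w : seq (helt V) => hvec (sword w)).
Proof.
move=> a u x y z v xz yz zE; apply: (@presented_lin (sbar_pres V)).
by apply: SbarTbar; apply: TbarLin.
Qed.

Lemma sword_sym V (u v : seq (helt V)) x y :
  hvec (sword (u ++ x :: y :: v)) =
  ksign K (hdeg x * hdeg y) *: hvec (sword (u ++ y :: x :: v)).
Proof.
apply/eqP; rewrite -subr_eq0; apply/eqP.
rewrite /hvec /= /gen -linearZ -linearB; apply: pi_relspan.
by apply: relspan_rel; apply: SbarSym.
Qed.

Lemma ksignD m n : ksign K (m + n) = ksign K m * ksign K n.
Proof. by rewrite /ksign expfzDr // oppr_eq0 oner_eq0. Qed.

Lemma ksign_sqr m : ksign K m * ksign K m = 1.
Proof. by rewrite /ksign -expfzMl mulrNN mulr1 exp1rz. Qed.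

Lemma ksign_cancel e m n : m + e = n -> ksign K m = ksign K (e + n).
Proof. by move=> <-; rewrite ksignD ksignD mulrCA ksign_sqr mulr1. Qed.

Lemma kexp_cat ds1 ds2 b1 b2 : size b1 = size ds1 ->
  kexp (ds1 ++ ds2) (b1 ++ b2) = kexp ds1 b1
    + (\sum_(e <- rmask b1 ds1) e) * (\sum_(e <- mask b2 ds2) e)
    + kexp ds2 b2.
Proof.
elim: b1 ds1 => [|c b IH] [|d ds] //=.
  by rewrite big_nil mul0r !add0r.
move=> [sd]; rewrite IH // mask_cat // big_cat /= /rmask /=.
by case: c => /=; rewrite ?big_cons; ring.
Qed.

Lemma size_masks n b : b \in masks n -> size b = n.
Proof.
elim: n b => [|n IH] b /=; first by rewrite inE => /eqP ->.
by rewrite mem_cat => /orP [] /mapP [c /IH <- ->].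
Qed.

Lemma masks_cat (R : nmodType) m n (F : bitseq -> R) :
  \sum_(b <- masks (m + n)) F b =
  \sum_(b1 <- masks m) \sum_(b2 <- masks n) F (b1 ++ b2).
Proof.
elim: m F => [|m IH] F; first by rewrite big_seq1.
by rewrite addSn /= !big_cat !big_map /= !IH.
Qed.

Lemma split_mask (T : Type) (u v : seq T) z (b : bitseq) : size b = size (u ++ z :: v) ->
  exists b1 c b2, [/\ b = b1 ++ c :: b2, size b1 = size u & size b2 = size v].
Proof.
rewrite size_cat /= => sb.
have hu : (size u < size b)%N by rewrite sb addnS ltnS leq_addr.
exists (take (size u) b), (nth false b (size u)), (drop (size u).+1 b); split.
- by rewrite -drop_nth // cat_take_drop.
- by rewrite size_take hu.
- by rewrite size_drop sb addnS subSS addKn.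
Qed.

Lemma mask_mid (T : Type) (u v : seq T) z (b1 : bitseq) c b2 : size b1 = size u ->
  mask (b1 ++ c :: b2) (u ++ z :: v) = mask b1 u ++ nseq c z ++ mask b2 v.
Proof. by move=> s1; rewrite mask_cat ?mask_cons. Qed.

Lemma rmask_mid (T : Type) (u v : seq T) z (b1 : bitseq) c b2 : size b1 = size u ->
  rmask (b1 ++ c :: b2) (u ++ z :: v) = rmask b1 u ++ nseq (~~ c) z ++ rmask b2 v.
Proof. by move=> s1; rewrite /rmask map_cat /= mask_mid ?size_map. Qed.

Lemma degs_mid V (u v : seq (helt V)) x z : hdeg x = hdeg z ->
  degs (u ++ x :: v) = degs (u ++ z :: v).
Proof. by move=> xz; rewrite /degs !map_cat /= xz. Qed.

Lemma word_deg_mid V (u v : seq (helt V)) x z : hdeg x = hdeg z ->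
  word_deg (u ++ x :: v) = word_deg (u ++ z :: v).
Proof. by move=> xz; rewrite !word_deg_cat !word_deg_cons xz. Qed.

Lemma unshuff_lin M i (Q : pred bitseq) (ds : seq int) a (F G H : bitseq -> M) :
  (forall b, size b = size ds -> Q b -> F b = a *: G b + H b) ->
  unshuff i Q ds F = a *: unshuff i Q ds G + unshuff i Q ds H.
Proof.
move=> E; rewrite /unshuff scaler_sumr -big_split big_seq_cond.
rewrite [RHS]big_seq_cond; apply: eq_bigr => b /andP [/size_masks sb /andP [_ Qb]].
by rewrite (E b sb Qb) scalerDr !scalerA mulrC.
Qed.

Section Split.
Variables (V W : gradedLmodType K) (wd : seq (helt V) -> helt W).
Hypothesis wd_deg : forall w, hdeg (wd w) = word_deg w.
Hypothesis wd_lin : multilinear (fun w => hvec (wd w)).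

Lemma tens_wordl a u x y z v t :
  hdeg x = hdeg z -> hdeg y = hdeg z -> hvec z = a *: hvec x + hvec y ->
  tens (wd (u ++ z :: v)) t =
  a *: tens (wd (u ++ x :: v)) t + tens (wd (u ++ y :: v)) t
  :> tensor W W.
Proof.
move=> xz yz zE; apply: tens_linl; last exact: wd_lin.
  by rewrite !wd_deg (word_deg_mid _ _ xz).
by rewrite !wd_deg (word_deg_mid _ _ yz).
Qed.

Lemma tens_wordr a u x y z v t :
  hdeg x = hdeg z -> hdeg y = hdeg z -> hvec z = a *: hvec x + hvec y ->
  tens t (wd (u ++ z :: v)) =
  a *: tens t (wd (u ++ x :: v)) + tens t (wd (u ++ y :: v))
  :> tensor W W.
Proof.
move=> xz yz zE; apply: tens_linr; last exact: wd_lin.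
  by rewrite !wd_deg (word_deg_mid _ _ xz).
by rewrite !wd_deg (word_deg_mid _ _ yz).
Qed.

Lemma split_lin a u x y z v b : size b = size (u ++ z :: v) ->
  hdeg x = hdeg z -> hdeg y = hdeg z -> hvec z = a *: hvec x + hvec y ->
  tens (wd (mask b (u ++ z :: v))) (wd (rmask b (u ++ z :: v))) =
  a *: tens (wd (mask b (u ++ x :: v))) (wd (rmask b (u ++ x :: v))) +
  tens (wd (mask b (u ++ y :: v))) (wd (rmask b (u ++ y :: v))).
Proof.
move=> sb xz yz zE; have [b1 [c [b2 [-> s1 s2]]]] := split_mask sb.
rewrite !mask_mid // !rmask_mid //.
by case: c => /=; [exact: tens_wordl|exact: tens_wordr].
Qed.
End Split.

Lemma scop0_respects V : @respects K (sbar_pres V) _ (fun w =>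
  \sum_(1 <= i < size w) unshuff i xpredT (degs w) (fun b =>
    tens (sword (mask b w)) (sword (rmask b w)))).
Proof.
apply: sbar_respects; first by rewrite big_geq.
  move=> a u x y z v xz yz zE; rewrite !size_cat /= scaler_sumr -big_split /=.
  apply: eq_bigr => i _; rewrite !(degs_mid _ _ xz) (degs_mid _ _ yz).
  apply: unshuff_lin => b; rewrite size_map => sb _.
  exact: split_lin (@hdeg_sword V) (@sword_multilinear V) _ _ _ _ _ _ _ sb _ _ _.
move=> u x y v; rewrite !size_cat /= scaler_sumr; apply: eq_bigr => i _.
rewrite /unshuff !size_map !size_cat /= scaler_sumr.
rewrite big_mkcond [RHS]big_mkcond /= !masks_cat big_seq [RHS]big_seq.
apply: eq_bigr => b1 /size_masks s1 /=; rewrite !map_cat /= !big_cat !big_map /=.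
have sd : size b1 = size (degs u) by rewrite size_map.
have ds p q : degs (u ++ p :: q :: v) = degs u ++ hdeg p :: hdeg q :: degs v.
  by rewrite /degs map_cat.
have wdE p q (w1 w2 : seq (helt V)) :
    word_deg (w1 ++ p :: q :: w2) = word_deg (w1 ++ q :: p :: w2).
  by rewrite !word_deg_cat !word_deg_cons [hdeg p + _]addrCA.
rewrite [RHS]addrACA; congr ((_ + _) + (_ + _)); apply: eq_bigr => b2 _;
  rewrite !andbT !count_cat /= ?add0n !ds !kexp_cat // !mask_cat // /rmask;
  rewrite !map_cat !mask_cat ?size_map //=; case: ifP => // _.
- rewrite (@tens_scalel _ _ (ksign K (hdeg x * hdeg y))
    (sword (mask b1 u ++ y :: x :: mask b2 v))); last 2 first.
  + exact: wdE.
  + exact: sword_sym.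
  rewrite !scalerA mulrC; congr (_ * ksign K _ *: _).
  by rewrite !big_cons; ring.
- rewrite scalerA -ksignD; congr (_ *: _); apply: ksign_cancel.
  by rewrite !big_cons; ring.
- rewrite scalerA -ksignD; congr (ksign K _ *: _).
  by rewrite !big_cons; ring.
- rewrite (@tens_scaler _ _ (ksign K (hdeg x * hdeg y))
    (sword (rmask b1 u ++ y :: x :: rmask b2 v))); last 2 first.
  + exact: wdE.
  + exact: sword_sym.
  rewrite !scalerA mulrC; congr (_ * ksign K _ *: _).
  by ring.
Qed.

Lemma zcop_respects V : @respects K (tbar_pres V) _ (fun w =>
  let n := size w in
  \sum_(1 <= i < n)
    unshuff i (fun b => ~~ nth true b n.-1) (degs w) (fun b =>
      tens (tword (mask b w)) (tword (rmask b w)))).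
Proof.
apply: tbar_respects; first by rewrite /= big_geq.
move=> a u x y z v xz yz zE /=; rewrite !size_cat /= scaler_sumr -big_split /=.
apply: eq_bigr => i _; rewrite !(degs_mid _ _ xz) (degs_mid _ _ yz).
apply: unshuff_lin => b; rewrite size_map => sb _.
exact: split_lin (@hdeg_tword V) (@tword_multilinear V) _ _ _ _ _ _ _ sb _ _ _.
Qed.

Lemma glift_lin (P : presentation K) M a (F G H : gens P -> M) x :
  (forall t, F t = a *: G t + H t) -> glift F x = a *: glift G x + glift H x.
Proof.
move=> E; rewrite /glift !fglift_sum scaler_sumr -big_split /=.
by apply: eq_bigr => t _; rewrite E scalerDr !scalerA mulrC.
Qed.

Lemma scop_linear V : linear (@scop K V).
Proof.
move=> a x y; rewrite /scop /scop0 (glift_linear (@scop0_respects V)).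
exact: tens_map_linear (@sh_linear K _) (@sh_linear K _) _ _ _.
Qed.

Section CCop.
Variables (V : gradedLmodType K) (cop : V -> tensor V V).
Hypothesis cop_linear : linear cop.
Implicit Types (u v w l r : seq (helt V)).

Lemma ccopA_letters_respects l1 l2 r :
  @respects K (tensor_pres V V) (tensor (Tbar V) (Tbar V)) (fun p =>
    tens (tword (l1 ++ [:: p.1; p.2] ++ l2)) (tword r)).
Proof.
apply: (tensor_respects (f := fun x y =>
  tens (tword (l1 ++ [:: x; y] ++ l2)) (tword r))) => a x y z w xz yz zE /=.
  exact: tens_wordl (@hdeg_tword V) (@tword_multilinear V) _ _ _ _ _ _ _ xz yz zE.
rewrite -!(cat_rcons w).
exact: tens_wordl (@hdeg_tword V) (@tword_multilinear V) _ _ _ _ _ _ _ xz yz zE.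
Qed.

Lemma ccopB_letters_respects l r :
  @respects K (tensor_pres V V) (tensor (Tbar V) (Tbar V)) (fun p =>
    ksign K (word_deg r * hdeg p.1) *:
    tens (tword (rcons l p.1)) (tword (rcons r p.2))).
Proof.
apply: (tensor_respects (f := fun x y => ksign K (word_deg r * hdeg x) *:
  tens (tword (rcons l x)) (tword (rcons r y)))) => a x y z w xz yz zE /=;
  rewrite -!cats1.
  rewrite (tens_wordl (@hdeg_tword V) (@tword_multilinear V) _ _ _ xz yz zE).
  by rewrite xz yz scalerDr !scalerA mulrC.
rewrite (tens_wordr (@hdeg_tword V) (@tword_multilinear V) _ _ _ xz yz zE).
by rewrite scalerDr !scalerA mulrC.
Qed.

Lemma word_deg_take u x z v k : hdeg x = hdeg z ->
  word_deg (take k (u ++ x :: v)) = word_deg (take k (u ++ z :: v)).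
Proof.
move=> xz; rewrite !take_cat; case: ifP => // _.
by case: (_ - _)%N => [|n] //=; rewrite !word_deg_cat !word_deg_cons xz.
Qed.

Lemma ccopA_multilinear : multilinear (ccopA cop).
Proof.
move=> a u x y z v xz yz zE; rewrite /ccopA !size_cat /= addnS /=.
rewrite scaler_sumr -big_split /= big_nat [RHS]big_nat.
apply: eq_bigr => k /andP [_ kn].
rewrite scaler_sumr -big_split /=; apply: eq_bigr => i _.
rewrite (degs_mid _ _ xz) (degs_mid _ _ yz).
apply: unshuff_lin => b; rewrite size_set_nth size_map size_cat /= addnS.
have -> : maxn k.+1 (size u + size v).+1 = (size u + size v).+1 by lia.
move=> sb /andP [bk _].
rewrite (word_deg_take _ _ _ xz) (word_deg_take _ _ _ yz).
have sb' : size b = size (u ++ z :: v) by rewrite sb size_cat /= addnS.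
have swap (s c : K) (A B C : tensor (Tbar V) (Tbar V)) :
  A = a *: B + C -> c *: A = a *: (c *: B) + c *: C.
  by move=> ->; rewrite scalerDr !scalerA mulrC.
apply: (swap 1) => {swap}.
have [b1 [c [b2 [bE s1 s2]]]] := split_mask sb'.
have [ku|uk|ku] := ltngtP k (size u).
- rewrite !nth_cat ku; apply: glift_lin => p.
  have tk s : take k (u ++ s) = take k u by rewrite take_cat ku.
  rewrite !tk bE !rmask_mid //.
  have dk s : drop k.+1 (u ++ s) = drop k.+1 u ++ s.
    rewrite drop_cat; case: ltnP => // h.
    by rewrite (_ : k.+1 - size u = 0)%N ?drop0 ?drop_oversize //; lia.
  have dkb s : drop k.+1 (b1 ++ s) = drop k.+1 b1 ++ s.
    rewrite drop_cat s1; case: ltnP => // h.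
    by rewrite (_ : k.+1 - size u = 0)%N ?drop0 ?drop_oversize ?s1 //; lia.
  rewrite !dk !dkb !mask_mid ?size_drop ?s1 //.
  case: c {bE} => /=; last first.
    exact: tens_wordr (@hdeg_tword V) (@tword_multilinear V) _ _ _ _ _ _ _ xz yz zE.
  have E s t : mask (take k (b1 ++ true :: b2)) (take k u) ++
      [:: p.1, p.2 & mask (drop k.+1 b1) (drop k.+1 u) ++ s :: t] =
      (mask (take k (b1 ++ true :: b2)) (take k u) ++
      [:: p.1, p.2 & mask (drop k.+1 b1) (drop k.+1 u)]) ++ s :: t.
    by rewrite -catA.
  rewrite !E.
  exact: tens_wordl (@hdeg_tword V) (@tword_multilinear V) _ _ _ _ _ _ _ xz yz zE.
- have kE : k = (size u + (k - size u).-1.+1)%N by lia.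
  set m := (k - size u).-1 in kE.
  have nthE s : nth (hcomp 0 0) (u ++ s :: v) k = nth (hcomp 0 0) v m.
    by rewrite kE nth_cat ifN ?addKn // -leqNgt leq_addr.
  rewrite !nthE; apply: glift_lin => p.
  have tk s : take k (u ++ s :: v) = u ++ s :: take m v.
    by rewrite kE take_cat ifN ?addKn // -leqNgt leq_addr.
  have tkb : take k b = b1 ++ c :: take m b2.
    by rewrite bE kE take_cat s1 ifN ?addKn // -leqNgt leq_addr.
  have dk s : drop k.+1 (u ++ s :: v) = drop m.+1 v.
    by rewrite kE -addnS drop_cat ifN ?addKn // -leqNgt leq_addr.
  rewrite !tk !tkb !dk bE !rmask_mid // !mask_mid //.
  case: c {bE tkb} => /=; last first.
    exact: tens_wordr (@hdeg_tword V) (@tword_multilinear V) _ _ _ _ _ _ _ xz yz zE.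
  rewrite -!catA /=.
  exact: tens_wordl (@hdeg_tword V) (@tword_multilinear V) _ _ _ _ _ _ _ xz yz zE.
- have bu : c = true by move: bk; rewrite bE ku -s1 nth_cat ltnn subnn.
  have nthE s : nth (hcomp 0 0) (u ++ s :: v) k = s.
    by rewrite ku nth_cat ltnn subnn.
  have tk s : take k (u ++ s :: v) = u by rewrite ku take_size_cat.
  have dk s : drop k.+1 (u ++ s :: v) = v.
    by rewrite ku -cat_rcons drop_size_cat // size_rcons.
  rewrite !nthE !tk !dk bE bu !rmask_mid // zE cop_linear.
  exact: glift_linear (ccopA_letters_respects _ _ _) _ _ _.
Qed.

Lemma ccopB_rcons u x : ccopB cop (rcons u x) =
  \sum_(0 <= i < (size u).+1)
    unshuff i xpredT (degs u) (fun b =>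
      ksign K (word_deg u) *:
      @glift K (tensor_pres V V) (tensor (Tbar V) (Tbar V)) (fun p =>
        ksign K (word_deg (rmask b u) * hdeg p.1) *:
        tens (tword (rcons (mask b u) p.1)) (tword (rcons (rmask b u) p.2)))
        (cop (hvec x))).
Proof.
case: u => [|y u]; first by [].
by rewrite /= belast_rcons last_rcons size_rcons.
Qed.

Lemma ccopB_multilinear : multilinear (ccopB cop).
Proof.
move=> a u x y z v xz yz zE.
have swap (c : K) (A B C : tensor (Tbar V) (Tbar V)) :
  A = a *: B + C -> c *: A = a *: (c *: B) + c *: C.
  by move=> ->; rewrite scalerDr !scalerA mulrC.
case/lastP: v => [|v t].
  rewrite !cats1 !ccopB_rcons scaler_sumr -big_split /=.
  apply: eq_bigr => i _; apply: unshuff_lin => b _ _.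
  apply: swap; rewrite zE cop_linear.
  exact: glift_linear (ccopB_letters_respects _ _) _ _ _.
rewrite -!rcons_cons -!rcons_cat !ccopB_rcons !size_cat /= scaler_sumr.
rewrite -big_split /=; apply: eq_bigr => i _.
rewrite (degs_mid _ _ xz) (degs_mid _ _ yz).
rewrite (word_deg_mid _ _ xz) (word_deg_mid _ _ yz).
apply: unshuff_lin => b; rewrite size_map => sb _.
apply: (swap _); apply: glift_lin => p.
have [b1 [c [b2 [-> s1 s2]]]] := split_mask sb.
rewrite !rmask_mid // !mask_mid //.
case: c => /=; rewrite !rcons_cat /=.
  apply: swap.
  exact: tens_wordl (@hdeg_tword V) (@tword_multilinear V) _ _ _ _ _ _ _ xz yz zE.
rewrite (word_deg_mid _ _ xz) (word_deg_mid _ _ yz); apply: swap.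
exact: tens_wordr (@hdeg_tword V) (@tword_multilinear V) _ _ _ _ _ _ _ xz yz zE.
Qed.

Lemma ccop_respects : @respects K (tbar_pres V) _
  (fun w => ccopA cop w - flip (ccopA cop w) + ccopB cop w).
Proof.
apply: tbar_respects.
  have A0 : ccopA cop [::] = 0 by rewrite /ccopA big_geq.
  have F0 : flip (0 : tensor (Tbar V) (Tbar V)) = 0.
    have := glift_linear (@flip_respects (Tbar V) (Tbar V)) (-1) 0 0.
    by rewrite scaler0 addr0 scaleN1r addNr.
  by rewrite A0 F0 subrr addr0.
move=> a u x y z v xz yz zE.
rewrite (ccopA_multilinear _ _ xz yz zE) (ccopB_multilinear _ _ xz yz zE).
rewrite /flip (glift_linear (@flip_respects (Tbar V) (Tbar V))).
rewrite opprD !scalerDr scalerN.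
by rewrite [X in X + _ = _]addrACA [LHS]addrACA.
Qed.
End CCop.

Section Bar.
Variable g : gradedLmodType K.

Lemma letter_proj_linear : linear (@letter_proj K g).
Proof. by move=> a x y; rewrite /letter_proj /sproj linearP
  (glift_linear (@sproj_respects (shift g))) linearP. Qed.

Lemma unsh_hvec V (x : helt (shift V)) :
  gproj (hdeg x - 1) (unsh (hvec x)) = unsh (hvec x).
Proof. by have /eqP := valP x => /(congr1 (@unsh K V)). Qed.

Lemma desuspend2_linear V : linear (@desuspend2 K V).
Proof. exact: tens_map_linear (@unsh_linear K V) (@unsh_linear K V). Qed.

Lemma leib_corestriction_respects (leib : {bilinear g -> g -> g}) :
  @respects K (tbar_pres (shift (Sbar (shift g)))) (shift (shift g)) (fun w =>
    if w is [:: c1; c2] then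
      sh (sh (tens_eval leib (@desuspend2 K g (@desuspend2 K (shift g)
        (tens_map 0 0 (@letter_proj K g) (@letter_proj K g) (tens c1 c2))))))
    else 0).
Proof.
pose F (t : tensor (shift (Sbar (shift g))) (shift (Sbar (shift g)))) : g :=
  tens_eval leib (@desuspend2 K g (@desuspend2 K (shift g)
        (tens_map 0 0 (@letter_proj K g) (@letter_proj K g) t))).
have Fl : linear F.
  move=> a x y; rewrite /F.
  rewrite (tens_map_linear _ _ letter_proj_linear letter_proj_linear).
  rewrite (@desuspend2_linear (shift g)) (@desuspend2_linear g).
  exact: (glift_linear (@tens_eval_respects _ _ leib)).
apply: tbar_respects => // a [|t [|t' u]] x y z v xz yz zE /=; last first.
- by case: u => [|? ?] /=; rewrite scaler0 addr0.
- case: v => [|? ?] /=; last by rewrite scaler0 addr0.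
  by rewrite -!/(F _) (tens_linr _ xz yz zE) Fl !linearP.
case: v => [|s [|? ?]] /=; rewrite ?scaler0 ?addr0 //.
by rewrite -!/(F _) (tens_linl _ xz yz zE) Fl !linearP.
Qed.

Lemma lie_corestriction_respects (lie : {bilinear g -> g -> g}) :
  bracket_degree 0 lie -> graded_antisymmetric lie ->
  @respects K (sbar_pres (shift g)) (shift (shift g)) (fun w =>
    if w is [:: a; b] then sh (sh (tens_eval lie (desuspend2 (tens a b))))
    else 0).
Proof.
move=> lie_deg lie_anti.
pose F (t : tensor (shift g) (shift g)) : g := tens_eval lie (desuspend2 t).
have Fl : linear F.
  move=> a x y; rewrite /F (@desuspend2_linear g).
  exact: (glift_linear (@tens_eval_respects _ _ lie)).
apply: sbar_respects => //.
  move=> a [|t [|t' u]] x y z v xz yz zE /=; last first.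
  - by case: u => [|? ?] /=; rewrite scaler0 addr0.
  - case: v => [|? ?] /=; last by rewrite scaler0 addr0.
    by rewrite -!/(F _) (tens_linr _ xz yz zE) Fl !linearP.
  case: v => [|s [|? ?]] /=; rewrite ?scaler0 ?addr0 //.
  by rewrite -!/(F _) (tens_linl _ xz yz zE) Fl !linearP.
have Fval x y :
    F (tens x y) = ksign K (- hdeg x) *: lie (unsh (hvec x)) (unsh (hvec y)).
  rewrite /F /desuspend2 (tens_map_tens _ _ _ _ (@unsh_linear K g) (@unsh_linear K g)).
  have el := glift_linear (@tens_eval_respects _ _ lie).
  have := el (ksign K (-1 * hdeg x)) (tens (hcomp (hdeg x + -1) (unsh (hvec x)))
    (hcomp (hdeg y + -1) (unsh (hvec y)))) 0.
  have -> : glift (fun p : gens (tensor_pres g g) => lie (hvec p.1) (hvec p.2)) 0 = 0.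
    by have := el (-1) 0 0; rewrite scaler0 addr0 scaleN1r addNr.
  rewrite !addr0 /tens_eval => ->; rewrite mulN1r; congr (_ *: _).
  rewrite (glift_gen (@tens_eval_respects _ _ lie)) /= !hvec_hcomp.
  by rewrite !unsh_hvec.
have Fsym x y : F (tens x y) = ksign K (hdeg x * hdeg y) *: F (tens y x).
  rewrite !Fval (lie_anti (hdeg x - 1) (hdeg y - 1)); last 2 first.
  - by apply/eqP; exact: unsh_hvec.
  - by apply/eqP; exact: unsh_hvec.
  rewrite scalerN -scaleNr !scalerA; congr (_ *: _).
  have -> : ksign K (- hdeg x) = - ksign K (1 - hdeg x).
    by rewrite ksignD /ksign expr1z mulN1r opprK.
  rewrite opprK -!ksignD.
  rewrite (@ksign_cancel (hdeg x) _ (hdeg x * hdeg y - hdeg y - hdeg x + 2)); last by ring.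
  rewrite (_ : hdeg x + _ = hdeg x * hdeg y - hdeg y + 1 + 1); last by ring.
  by rewrite !ksignD -!mulrA ksign_sqr mulr1.
move=> [|a [|b [|c u]]] x y v /=; last by rewrite scaler0.
- case: v => [|s v] /=; last by rewrite scaler0.
  by rewrite -!/(F _) Fsym !linearZ.
- by rewrite scaler0.
- by rewrite scaler0.
Qed.
End Bar.

End WellDefined.

(* Main.v *)
From HB Require Import structures.
Require Import Defs.
From mathcomp Require Import all_boot all_algebra sesquilinear.
From mathcomp Require Import zify ring.

Set Implicit Arguments.
Unset Strict Implicit.
Unset Printing Implicit Defensive.

Import GRing.Theory.
Local Open Scope ring_scope.

(* A coderivation of degree -1 has a square which is again a coderivation, and
   a coderivation whose corestriction to the cogenerators vanishes is zero: by
   induction on the number of letters of g, its values are primitive, and in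
   characteristic 0 the primitive elements of the bar coalgebra are the
   cogenerators. So D = dLie + dLeib squares to zero iff the corestriction of
   D D vanishes.
   The corestriction of D only involves the components of an element in
   s S^2 s g and in (s s g)^(x)2, which can be read off from the coproducts:
   it is 1/2 lie (pi (x) pi) Delta_c - leib (pi (x) pi) Delta_z, where pi is
   the projection to g. Hence the corestriction of D D at x is computed by
   applying D (x) 1 + 1 (x) D to the coproducts of x. It vanishes unless x has
   exactly three letters of g, and on the words s(abc), s(ab) s(c), s(a) s(bc)
   and s(a) s(b) s(c) it gives, up to sign, the Jacobi identity, the two
   compatibilities and the odd Leibniz identity. *)

(** * Linear maps on presented graded spaces, and Koszul signs *)

Section Linear.
Variables (K : fieldType) (U V : lmodType K) (f : U -> V).
Hypothesis fl : linear f.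

Let F : {linear U -> V} := HB.pack f (GRing.isLinear.Build _ _ _ _ _ fl).

Lemma lin0 : f 0 = 0. Proof. exact: (linear0 F). Qed.
Lemma linD x y : f (x + y) = f x + f y. Proof. exact: (linearD F). Qed.
Lemma linN x : f (- x) = - f x. Proof. exact: (linearN F). Qed.
Lemma linZ a x : f (a *: x) = a *: f x. Proof. exact: (linearZ_LR F). Qed.

Lemma lin_sum I (r : seq I) (P : pred I) (G : I -> U) :
  f (\sum_(i <- r | P i) G i) = \sum_(i <- r | P i) f (G i).
Proof. exact: (linear_sum F). Qed.

Lemma lin_unshuff i Q ds (G : bitseq -> U) :
  f (unshuff i Q ds G) = unshuff i Q ds (fun b => f (G b)).
Proof. by rewrite /unshuff lin_sum; apply: eq_bigr => b _; rewrite linZ. Qed.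

End Linear.

Lemma linear_add (K : fieldType) (U V : lmodType K) (f h : U -> V) :
  linear f -> linear h -> linear (fun x => f x + h x).
Proof. by move=> fl hl a x y; rewrite fl hl scalerDr addrACA. Qed.

Lemma linear_scale (K : fieldType) (U V : lmodType K) c (f : U -> V) :
  linear f -> linear (fun x => c *: f x).
Proof. by move=> fl a x y; rewrite fl scalerDr !scalerA mulrC. Qed.

Lemma linear_comp (K : fieldType) (U V W : lmodType K) (f : V -> W) (h : U -> V) :
  linear f -> linear h -> linear (fun x => f (h x)).
Proof. by move=> fl hl a x y; rewrite hl fl. Qed.

Section Generators.
Variable K : fieldType.

Lemma presented_eq0 (P : presentation K) (M : lmodType K) (f : presented P -> M) :
  linear f -> (forall t, f (gen P t) = 0) -> forall x, f x = 0.
Proof.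
move=> fl f0; apply: presented_ind => [a x y fx fy||//].
  by rewrite fl fx fy scaler0 addr0.
exact: lin0.
Qed.

Lemma presented_ext (P : presentation K) (M : lmodType K) (f h : presented P -> M) :
  linear f -> linear h -> (forall t, f (gen P t) = h (gen P t)) -> f =1 h.
Proof.
move=> fl hl fh x; apply/eqP; rewrite -subr_eq0 -scaleN1r; apply/eqP.
apply: (presented_eq0 (linear_add fl (linear_scale (-1) hl))) => t /=.
by rewrite fh scaleN1r subrr.
Qed.

Lemma tensor_ext (V W : gradedLmodType K) (M : lmodType K)
    (f h : tensor V W -> M) :
  linear f -> linear h -> (forall v w, f (tens v w) = h (tens v w)) -> f =1 h.
Proof. by move=> fl hl fh; apply: presented_ext => // -[v w]; apply: fh. Qed.

Lemma helt_ext (V : gradedLmodType K) (x y : helt V) :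
  hdeg x = hdeg y -> hvec x = hvec y -> x = y.
Proof.
case: x => -[d v] p; case: y => -[e w] q; rewrite /hdeg /hvec /= => de vw.
by apply: val_inj => /=; rewrite de vw.
Qed.

Lemma homog_hvec (V : gradedLmodType K) (x : helt V) : homog (hdeg x) (hvec x).
Proof. exact: valP x. Qed.

Lemma gproj_hvec (V : gradedLmodType K) d (x : helt V) :
  gproj d (hvec x) = if hdeg x == d then hvec x else 0.
Proof. by have /eqP <- := homog_hvec x; rewrite gprojE eq_sym. Qed.

Lemma hcomp_hvec (V : gradedLmodType K) (x : helt V) :
  hcomp (hdeg x) (hvec x) = x.
Proof. by apply: helt_ext => //; rewrite hvec_hcomp gproj_hvec eqxx. Qed.

Lemma hvec_hcomp_homog (V : gradedLmodType K) d (v : V) :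
  homog d v -> hvec (hcomp d v) = v.
Proof. by move=> /eqP. Qed.

Lemma ksign0 : ksign K 0 = 1. Proof. by []. Qed.

Lemma ksignN m : ksign K (- m) = ksign K m.
Proof. by rewrite (@ksign_cancel K m _ 0) ?addr0 // addNr. Qed.

Lemma ksign_neq0 m : ksign K m != 0.
Proof.
by apply: contra_eq_neq (ksign_sqr K m) => ->; rewrite mul0r eq_sym oner_neq0.
Qed.

Lemma scale_ksignK (M : lmodType K) m (x : M) : ksign K m *: (ksign K m *: x) = x.
Proof. by rewrite scalerA ksign_sqr scale1r. Qed.

(** Signs become powers with boolean exponents, so that sign identities reduce to cases on the
    parities of the degrees. *)
Lemma ksignE m : ksign K m = (-1) ^+ odd `|m|%N.
Proof.
rewrite /ksign; case: m => n; first by rewrite -exprnP signr_odd.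
by rewrite NegzE abszN -invr_expz -exprnP signr_odd -exprVn invrN1.
Qed.

Lemma odd_abszD (m n : int) : odd `|(m + n)%R|%N = odd `|m|%N (+) odd `|n|%N.
Proof. lia. Qed.

Lemma odd_abszM (m n : int) : odd `|(m * n)%R|%N = odd `|m|%N && odd `|n|%N.
Proof. by rewrite abszM oddM. Qed.

End Generators.
(** Each mask has exactly one number of set bits, so the sum over [i] only leaves a range condition
    on that number. *)
Lemma sum_unshuff (K : fieldType) (M : lmodType K) m n Q ds (F : bitseq -> M) :
  \sum_(m <= i < n) unshuff i Q ds F =
  \sum_(b <- masks (size ds) | (m <= count id b < n)%N && Q b)
    ksign K (kexp ds b) *: F b.
Proof.
rewrite /unshuff; under eq_bigr do rewrite big_mkcond.
rewrite exchange_big /= [RHS]big_mkcond; apply: eq_bigr => b _.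
case: (Q b); last by rewrite big1 ?andbF // => i _; rewrite andbF.
rewrite andbT -big_mkcond /= (eq_bigl (fun i => i == count id b)).
  by rewrite big_nat1_eq.
by move=> i; rewrite andbT eq_sym.
Qed.

(** * Words of letters and their weight *)

Section Letters.
Variables (K : fieldType) (V : gradedLmodType K).
Local Notation W := (shift (Sbar V)).
Implicit Types (w : seq (helt V)) (ws : seq (seq (helt V))).

Definition letter w : helt W := hcomp (word_deg w + 1) (sh (hvec (sword w))).

(* The words in the letters s(v_1 ... v_n) span the bar coalgebra (bword_eq0);
   wt counts the letters v_i. *)
Definition bword ws : helt (Tbar W) := tword (map letter ws).

Lemma hdeg_letter w : hdeg (letter w) = word_deg w + 1.
Proof. by []. Qed.

Lemma hvec_letter w : hvec (letter w) = sh (hvec (sword w)).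
Proof.
rewrite /letter hvec_hcomp {1}/gproj /= /shift_proj /= addrK.
by have /eqP -> := homog_hvec (sword w).
Qed.

Lemma scop_letter w : scop (hvec (letter w)) =
  \sum_(1 <= i < size w) unshuff i xpredT (degs w) (fun b =>
    ksign K (word_deg (mask b w)) *:
      tens (letter (mask b w)) (letter (rmask b w))).
Proof.
rewrite hvec_letter /scop /scop0 (glift_gen (@scop0_respects K V)).
have sl := tens_map_linear 1 1 (@sh_linear K (Sbar V)) (@sh_linear K (Sbar V)).
rewrite (lin_sum sl); apply: eq_bigr => i _; rewrite (lin_unshuff sl).
apply: eq_bigr => b _; congr (_ *: _).
rewrite (tens_map_tens _ _ _ _ (@sh_linear K (Sbar V)) (@sh_linear K (Sbar V))).
by rewrite mul1r.
Qed.

Lemma glift_scop (M : lmodType K) (F : gens (tensor_pres W W) -> M) w :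
  respects F -> glift F (scop (hvec (letter w))) =
  \sum_(1 <= i < size w) unshuff i xpredT (degs w) (fun b =>
    ksign K (word_deg (mask b w)) *: F (letter (mask b w), letter (rmask b w))).
Proof.
move=> hF; have Fl := glift_linear hF; rewrite scop_letter (lin_sum Fl).
apply: eq_bigr => i _; rewrite (lin_unshuff Fl); apply: eq_bigr => b _.
by congr (_ *: _); rewrite (linZ Fl) (glift_gen hF).
Qed.

Lemma tword_zero (U : gradedLmodType K) u (x : helt U) v :
  hvec x = 0 -> hvec (tword (u ++ x :: v)) = 0.
Proof.
move=> x0; have := @tword_multilinear K U (-1) u x x x v erefl erefl.
by rewrite x0 scaler0 addr0 => /(_ erefl) ->; rewrite scaleN1r addNr.
Qed.

Definition nonnil ws := all (fun w => 0 < size w)%N ws.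
(** A word with no letter, or with an empty letter, represents zero in the bar coalgebra; the
    remaining words are the ones to be tested. *)
Definition good ws := (0 < size ws)%N && nonnil ws.
Definition wt ws : nat := sumn (map size ws).

(** Arbitrary letters are replaced by letters [s(v_1 ... v_n)] one position at a time: the value is
    linear in each letter, and a generator that is empty or of the wrong degree is projected to
    zero. *)
Lemma bword_eq0 (M : lmodType K) (f : Tbar W -> M) : linear f ->
  (forall ws, good ws -> f (hvec (bword ws)) = 0) -> forall x, f x = 0.
Proof.
move=> fl f0; apply: (presented_eq0 fl) => w.
(* The letters of [u] already have the required form, those of [v] are still arbitrary; the
   induction is on [v]. *)
suff H v u : nonnil u -> f (hvec (tword (map letter u ++ v))) = 0.
  exact: (H w [::]).
elim: v u => [|x v IH] u nu.
  rewrite cats0; case: u nu => [_|t u nu]; first by rewrite tword0 (lin0 fl).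
  by apply: (f0 (t :: u)); rewrite /good.
pose h (y : Sbar V) :=
  f (hvec (tword (map letter u ++ hcomp (hdeg x) (sh y) :: v))).
have hl : linear h.
  move=> a y z; rewrite /h -fl; congr (f _).
  by apply: tword_multilinear; rewrite // !hvec_hcomp -linearP.
have -> : x = hcomp (hdeg x) (sh (unsh (hvec x))).
  by rewrite -[LHS]hcomp_hvec; case: (hvec x).
apply: (presented_eq0 hl) => {}w; rewrite /h.
have z0 : hvec (hcomp (hdeg x) (sh (gen (sbar_pres V) w)) : helt W) = 0 ->
    f (hvec (tword
      (map letter u ++ hcomp (hdeg x) (sh (gen (sbar_pres V) w)) :: v))) = 0.
  by move=> /(@tword_zero W) ->; rewrite (lin0 fl).
case: (posnP (size w)) => [/size0nil w0|w0].
  apply: z0; rewrite hvec_hcomp w0.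
  by rewrite [gen _ _](@sword0 K V) [sh 0](linear0 (@sh K (Sbar V))) linear0.
have [wx|wx] := eqVneq (word_deg w + 1) (hdeg x).
  have := IH (rcons u w); rewrite map_rcons cat_rcons -wx; apply.
  by rewrite /nonnil all_rcons w0.
apply: z0; rewrite hvec_hcomp.
have -> : sh (gen (sbar_pres V) w) = hvec (letter w) by rewrite hvec_letter.
by rewrite gproj_hvec hdeg_letter (negPf wx).
Qed.

Lemma bword_ext (M : lmodType K) (f h : Tbar W -> M) : linear f -> linear h ->
  (forall ws, good ws -> f (hvec (bword ws)) = h (hvec (bword ws))) -> f =1 h.
Proof.
move=> fl hl fh x; apply/eqP; rewrite -subr_eq0 -scaleN1r; apply/eqP.
apply: (bword_eq0 (linear_add fl (linear_scale (-1) hl))) => ws gws.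
by rewrite fh // scaleN1r subrr.
Qed.

Lemma wt_cat ws1 ws2 : wt (ws1 ++ ws2) = (wt ws1 + wt ws2)%N.
Proof. by rewrite /wt map_cat sumn_cat. Qed.

Lemma wt_cons w ws : wt (w :: ws) = (size w + wt ws)%N.
Proof. by []. Qed.

Lemma size_mask_rmask (T : Type) (b : bitseq) (w : seq T) : size b = size w ->
  (size (mask b w) + size (rmask b w))%N = size w.
Proof.
move=> sb; rewrite size_mask // size_mask ?size_map // count_map.
by rewrite -sb -(count_predC id).
Qed.

Lemma wt_mask (b : bitseq) ws : size b = size ws ->
  (wt (mask b ws) + wt (rmask b ws))%N = wt ws.
Proof.
elim: b ws => [|c b IH] [|w ws] //= [/IH]; rewrite !wt_cons => <-.
by case: c; rewrite /rmask /= !wt_cons; lia.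
Qed.

Lemma nonnil_mask (b : bitseq) ws : nonnil ws -> nonnil (mask b ws).
Proof. by move=> /allP h; apply/allP => w /mem_mask /h. Qed.

Lemma nonnil_cat ws1 ws2 : nonnil (ws1 ++ ws2) = nonnil ws1 && nonnil ws2.
Proof. exact: all_cat. Qed.

Lemma nonnil_rcons ws w : nonnil (rcons ws w) = (0 < size w)%N && nonnil ws.
Proof. exact: all_rcons. Qed.

Lemma zcop_bword ws : zcop (hvec (bword ws)) =
  \sum_(1 <= i < size ws)
    unshuff i (fun b => ~~ nth true b (size ws).-1) (degs (map letter ws))
      (fun b => tens (bword (mask b ws)) (bword (rmask b ws))).
Proof.
rewrite /zcop (glift_gen (@zcop_respects K W)) size_map.
apply: eq_bigr => i _; apply: eq_bigr => b _.
by rewrite /bword /rmask !map_mask.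
Qed.

Section Weights.
Variables (M : lmodType K) (G : tensor (Tbar W) (Tbar W) -> M).
Hypothesis Gl : linear G.

(** An unshuffle distributes the letters over two nonempty words, so the weights of the factors add
    up to that of [ws]. *)
Lemma zcop_wt0 ws : nonnil ws ->
  (forall ws1 ws2, good ws1 -> good ws2 -> (wt ws1 + wt ws2)%N = wt ws ->
     G (tens (bword ws1) (bword ws2)) = 0) ->
  G (zcop (hvec (bword ws))) = 0.
Proof.
move=> nn G0; rewrite zcop_bword (lin_sum Gl) big_nat big1 // => i /andP [i0 iw].
rewrite (lin_unshuff Gl) /unshuff big_seq_cond big1 // => b.
rewrite !size_map => /andP [/size_masks sb /andP [/eqP bi _]].
have sm := size_mask_rmask sb; have s1 := size_mask sb.
rewrite G0 ?scaler0 ?wt_mask // /good nonnil_mask //; first by rewrite s1 bi i0.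
by rewrite andbT; lia.
Qed.

(** A term of [ccop] splits one letter into two nonempty ones: the total weight is kept while the
    number of letters grows by one. Recording both excludes more pairs of words than the weight
    alone. *)
Definition ccop_null ws := forall ws1 ws2, good ws1 -> good ws2 ->
  (wt ws1 + wt ws2)%N = wt ws -> (size ws1 + size ws2)%N = (size ws).+1 ->
  G (tens (bword ws1) (bword ws2)) = 0.

Lemma ccopA_wt0 ws : nonnil ws -> ccop_null ws ->
  G (ccopA (@scop K V) (map letter ws)) = 0.
Proof.
move=> nn G0; rewrite /ccopA size_map (lin_sum Gl) big_nat big1 // => k kn.
rewrite (lin_sum Gl) big_nat big1 // => i /andP [i0 iw].
rewrite (lin_unshuff Gl) /unshuff big_seq_cond big1 // => b.
rewrite size_set_nth !size_map => /andP [/size_masks sb].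
have {}sb : size b = size ws by lia.
move=> /andP [/eqP bi /andP [bk _]].
have kb : (k < size ws)%N by lia.
rewrite (linZ Gl) (nth_map [::]) // glift_scop; last first.
  exact: ccopA_letters_respects.
rewrite (lin_sum Gl) big_nat big1 ?scaler0 // => j /andP [j0 jw].
rewrite (lin_unshuff Gl) /unshuff big_seq_cond big1 ?scaler0 // => c.
rewrite size_map => /andP [/size_masks sc /andP [/eqP cj _]].
have sm := size_mask_rmask sc; have s1 := size_mask sc.
(* The mask and the word are cut at the split letter [k], whose bit is set because it goes to the
   left factor. *)
have bE : b = take k b ++ true :: drop k.+1 b.
  by rewrite -[LHS](cat_take_drop k) (drop_nth false) ?sb // bk.
have wE : ws = take k ws ++ nth [::] ws k :: drop k.+1 ws.
  by rewrite -[LHS](cat_take_drop k) (drop_nth [::]).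
have st : size (take k b) = size (take k ws) by rewrite !size_take sb.
(* The left word after its letter [k] has been replaced by the two parts that [c] cuts out of it. *)
set l := mask (take k b) (take k ws) ++
  [:: mask c (nth [::] ws k); rmask c (nth [::] ws k)] ++
  mask (drop k.+1 b) (drop k.+1 ws).
have mE : mask b ws = mask (take k b) (take k ws) ++ nth [::] ws k ::
    mask (drop k.+1 b) (drop k.+1 ws).
  by rewrite {1}bE {1}wE mask_mid.
have sl : size l = (size (mask b ws)).+1 by rewrite mE !size_cat /=; lia.
have wl : wt l = wt (mask b ws).
  by rewrite mE !wt_cat !wt_cons (_ : wt [::] = 0%N) // -sm; lia.
have sb1 := size_mask sb; have sb2 := size_mask_rmask sb.
rewrite (linZ Gl) -map_take -map_drop.
have -> : G (tens (tword (mask (take k b) (map letter (take k ws)) ++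
    [:: (letter (mask c (nth [::] ws k)), letter (rmask c (nth [::] ws k))).1;
        (letter (mask c (nth [::] ws k)), letter (rmask c (nth [::] ws k))).2]
    ++ mask (drop k.+1 b) (map letter (drop k.+1 ws))))
    (tword (rmask b (map letter ws)))) = 0.
  have -> : tword (rmask b (map letter ws)) = bword (rmask b ws).
    by rewrite /bword /rmask map_mask.
  rewrite -!map_mask /=.
  have -> : [:: letter (mask c (nth [::] ws k)), letter (rmask c (nth [::] ws k))
    & map letter (mask (drop k.+1 b) (drop k.+1 ws))] = map letter
      ([:: mask c (nth [::] ws k); rmask c (nth [::] ws k)] ++
      mask (drop k.+1 b) (drop k.+1 ws)) by [].
  rewrite -map_cat; apply: G0.
  - move: (nn); rewrite {1}wE nonnil_cat => /andP [nt] /= /andP [_ nd].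
    rewrite /good sl /l !nonnil_cat !nonnil_mask //= nonnil_mask // andbT.
    by apply/andP; split; lia.
  - rewrite /good nonnil_mask // andbT; lia.
  - by rewrite wl wt_mask.
  - by rewrite sl; lia.
by rewrite !scaler0.
Qed.

Lemma ccopB_wt0 ws : nonnil ws -> ccop_null ws ->
  G (ccopB (@scop K V) (map letter ws)) = 0.
Proof.
case/lastP: ws => [|u z] nn G0; first exact: lin0.
rewrite map_rcons ccopB_rcons size_map (lin_sum Gl) big1_seq // => i _.
rewrite (lin_unshuff Gl) /unshuff big_seq_cond big1 // => b.
rewrite !size_map => /andP [/size_masks sb _].
rewrite (linZ Gl) glift_scop; last exact: ccopB_letters_respects.
rewrite (lin_sum Gl) big_nat big1 ?scaler0 // => j /andP [j0 jw].
rewrite (lin_unshuff Gl) /unshuff big_seq_cond big1 ?scaler0 // => c.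
rewrite size_map => /andP [/size_masks sc /andP [/eqP cj _]].
have sm := size_mask_rmask sc; have s1 := size_mask sc.
have sb1 := size_mask_rmask sb; rewrite /rmask in sm sb1.
move: (nn); rewrite nonnil_rcons => /andP [z0 nu].
rewrite !(linZ Gl) /= /rmask -!map_mask -!map_rcons G0 ?scaler0 //.
- by rewrite /good nonnil_rcons nonnil_mask // size_rcons andbT /=; lia.
- by rewrite /good nonnil_rcons nonnil_mask // size_rcons andbT /=; lia.
- rewrite -!cats1 !wt_cat !wt_cons -(wt_mask sb) (_ : wt [::] = 0%N) // -sm.
  by rewrite /rmask; lia.
- by rewrite !size_rcons -sb1; lia.
Qed.
End Weights.

Lemma ccop_wt0 (M : lmodType K) (G : tensor (Tbar W) (Tbar W) -> M) ws :
  linear G -> nonnil ws -> ccop_null G ws ->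
  G (ccop (@scop K V) (hvec (bword ws))) = 0.
Proof.
move=> Gl nn G0.
have fl := glift_linear (@flip_respects K (Tbar W) (Tbar W)).
rewrite /ccop (glift_gen (ccop_respects (@scop_linear K V))).
rewrite (linD Gl) (linD Gl) (linN Gl) ccopA_wt0 // ccopB_wt0 // addr0 sub0r.
(* The flipped term is covered by the same hypothesis, which is symmetric in the two words. *)
rewrite (ccopA_wt0 (G := fun t => G (flip t)) (linear_comp Gl fl)) ?oppr0 //.
move=> ws1 ws2 g1 g2 wE sE; rewrite /flip (glift_gen (@flip_respects K _ _)).
by rewrite (linZ Gl) G0 ?scaler0 // addnC.
Qed.
End Letters.
(** * Coderivations *)

Section Coderivations.
Variables (K : fieldType) (g : gradedLmodType K).
Implicit Types (D E : bar g -> bar g) (t : tensor (bar g) (bar g)).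

Lemma id_linear (U : lmodType K) : linear (@id U). Proof. by []. Qed.

Lemma tens_deriv_linear k D : linear D -> linear (tens_deriv k D).
Proof.
move=> Dl; apply: linear_add; apply: tens_map_linear => //; exact: id_linear.
Qed.

Lemma tens_deriv_tens k D x y : linear D -> tens_deriv k D (tens x y) =
  tens (hcomp (hdeg x + k) (D (hvec x))) y +
  ksign K (k * hdeg x) *: tens x (hcomp (hdeg y + k) (D (hvec y))).
Proof.
move=> Dl; rewrite /tens_deriv !tens_map_tens //; try exact: id_linear.
by rewrite mul0r scale1r !addr0 !hcomp_hvec.
Qed.

Lemma coder_hvec k D (x : helt (bar g)) : coderivation k D ->
  hvec (hcomp (hdeg x + k) (D (hvec x))) = D (hvec x).
Proof. by move=> cD; apply/hvec_hcomp_homog/(coder_degree cD)/homog_hvec. Qed.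

Lemma hcompD (U : gradedLmodType K) d (u v : U) :
  hvec (hcomp d (u + v)) = 1 *: hvec (hcomp d u) + hvec (hcomp d v).
Proof. by rewrite !hvec_hcomp linearD scale1r. Qed.

Lemma tens_deriv_add k D E t : linear D -> linear E ->
  tens_deriv k (D \+ E) t = tens_deriv k D t + tens_deriv k E t.
Proof.
move=> Dl El; have DEl : linear (D \+ E) by exact: linear_add.
move: t; apply: tensor_ext => [||x y].
- exact: tens_deriv_linear.
- by apply: linear_add; exact: tens_deriv_linear.
rewrite !tens_deriv_tens // (tens_linl y _ _ (hcompD _ _ _)) //.
by rewrite (tens_linr x _ _ (hcompD _ _ _)) // !scale1r scalerDr addrACA.
Qed.

Lemma coderivation_add k D E :
  coderivation k D -> coderivation k E -> coderivation k (D \+ E).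
Proof.
move=> cD cE; have Dl := coder_linear cD; have El := coder_linear cE.
split=> [|d x hx|x|x].
- exact: linear_add.
- have /eqP hD := coder_degree cD hx; have /eqP hE := coder_degree cE hx.
  by apply/eqP; rewrite [LHS]linearD; congr (_ + _).
- rewrite tens_deriv_add // (coder_zcop cD) (coder_zcop cE).
  by rewrite /bar_zcop -(linD (glift_linear (@zcop_respects K _))).
- rewrite tens_deriv_add // scalerDr (coder_ccop cD) (coder_ccop cE).
  by rewrite /bar_ccop -(linD (glift_linear (ccop_respects (@scop_linear K _)))).
Qed.

(** The cross terms of [(D (x) 1 + 1 (x) D)^2] cancel because [D] is odd: applying [D] to the left
    factor first changes the sign of moving the second [D] past it. *)
Lemma tens_deriv_square D t : coderivation (-1) D ->
  tens_deriv (-1) D (tens_deriv (-1) D t) = tens_deriv (-2) (fun x => D (D x)) t.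
Proof.
move=> cD; have Dl := coder_linear cD.
have DDl : linear (fun x => D (D x)) by exact: linear_comp.
have tl := tens_deriv_linear (-1) Dl.
move: t; apply: tensor_ext => [||x y].
- exact: (linear_comp tl tl).
- exact: tens_deriv_linear.
have hD (z : helt (bar g)) : hcomp (hdeg (hcomp (hdeg z - 1) (D (hvec z))) - 1)
    (D (hvec (hcomp (hdeg z - 1) (D (hvec z))))) =
    hcomp (hdeg z - 2) (D (D (hvec z))).
  by rewrite hdeg_hcomp coder_hvec // -addrA.
rewrite [in LHS]tens_deriv_tens // (linD tl) (linZ tl) !tens_deriv_tens // !hD.
rewrite hdeg_hcomp !scalerDr !scalerA -!ksignD.
have -> : ksign K (-1 * (hdeg x - 1)) = - ksign K (-1 * hdeg x).
  rewrite (_ : -1 * (hdeg x - 1) = 1 + -1 * hdeg x); last by ring.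
  by rewrite ksignD [ksign K 1]expr1z -[RHS]mulN1r.
rewrite scaleNr -!addrA; congr (_ + _); rewrite addKr; congr (_ *: _).
by rewrite -mulrDl.
Qed.

Lemma coder_square_zcop D x : coderivation (-1) D ->
  bar_zcop (D (D x)) = tens_deriv (-2) (fun x => D (D x)) (bar_zcop x).
Proof. by move=> cD; rewrite -!(coder_zcop cD) tens_deriv_square. Qed.

(** The sign [(-1)^|D|] of the compatibility with [bar_ccop] occurs twice and cancels, so the square
    satisfies the identity of an even coderivation. *)
Lemma coder_square_ccop D x : coderivation (-1) D ->
  bar_ccop (D (D x)) = tens_deriv (-2) (fun x => D (D x)) (bar_ccop x).
Proof.
move=> cD; have tl := tens_deriv_linear (-1) (coder_linear cD).
by rewrite -!(coder_ccop cD) (linZ tl) scale_ksignK tens_deriv_square.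
Qed.

End Coderivations.

Lemma masks_all (R : nmodType) n (F : bitseq -> R) :
  \sum_(b <- masks n | all id b) F b = F (nseq n true).
Proof.
elim: n F => [|n IH] F /=; first by rewrite big_mkcond big_seq1.
rewrite big_cat !big_map /= IH (eq_bigl (fun=> false)) // big_pred0_eq.
exact: addr0.
Qed.

(** * Primitive elements *)

Section Concatenation.
Variables (K : fieldType) (V : gradedLmodType K).

(** The empty word is zero in [Tbar], so it must be sent to zero and not to the one-letter word
    [c]. *)
Definition append_letter (x : Tbar V) (c : helt V) : Tbar V :=
  @glift K (tbar_pres V) _
    (fun w => if nilp w then 0 else hvec (tword (rcons w c))) x.

Lemma append_letter_respects (c : helt V) : @respects K (tbar_pres V) _
  (fun w => if nilp w then 0 else hvec (tword (rcons w c))).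
Proof.
apply: tbar_respects => // a u x y z v xz yz zE.
have nE s : nilp (u ++ s :: v) = false by case: (u).
by rewrite !nE !rcons_cat !rcons_cons; apply: tword_multilinear.
Qed.

Lemma append_letter_lin a x y z t :
  hdeg x = hdeg z -> hdeg y = hdeg z -> hvec z = a *: hvec x + hvec y ->
  append_letter t z = a *: append_letter t x + append_letter t y.
Proof.
move=> xz yz zE; apply: glift_lin => w; case: nilp; first by rewrite scaler0 addr0.
by rewrite -!cats1; apply: tword_multilinear.
Qed.

Lemma tproj_linear : linear (@tproj K V).
Proof. exact: glift_linear (@tproj_respects K V). Qed.

(* Recovers a word with at least two letters from its coproduct, by
   concatenating the terms whose right factor is a single letter. *)
Definition zcat (t : tensor (Tbar V) (Tbar V)) : Tbar V :=
  @glift K (tensor_pres _ _) _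
    (fun p => append_letter (hvec p.1) (hcomp (hdeg p.2) (tproj (hvec p.2)))) t.

Lemma zcat_respects : @respects K (tensor_pres (Tbar V) (Tbar V)) _
  (fun p => append_letter (hvec p.1) (hcomp (hdeg p.2) (tproj (hvec p.2)))).
Proof.
apply: (tensor_respects (f := fun x y =>
  append_letter (hvec x) (hcomp (hdeg y) (tproj (hvec y)))))
  => a x y z w xz yz zE.
  by rewrite zE; exact: (glift_linear (@append_letter_respects _)).
apply: append_letter_lin; rewrite ?hdeg_hcomp //.
by rewrite !hvec_hcomp zE tproj_linear xz yz linearP.
Qed.

Lemma zcat_linear : linear zcat.
Proof. exact: glift_linear zcat_respects. Qed.

Lemma zcat_tword u v :
  zcat (tens (tword u) (tword v)) =
  if v is [:: x] then (if nilp u then 0 else hvec (tword (rcons u x))) else 0.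
Proof.
rewrite /zcat (glift_gen zcat_respects) /append_letter.
rewrite (glift_gen (@append_letter_respects _)) /tproj.
rewrite (glift_gen (@tproj_respects K V)) /=.
case: v => [|x [|y v]]; try rewrite hdeg_tword.
- by case: nilp; rewrite // -cats1 tword_zero // hvec_hcomp linear0.
- by rewrite /word_deg big_seq1 hcomp_hvec.
- by case: nilp; rewrite // -cats1 tword_zero // hvec_hcomp linear0.
Qed.

Lemma kexp_true ds n : kexp ds (nseq n true) = 0.
Proof. by elim: n ds => [|n IH] [|d ds] //=; rewrite IH addr0. Qed.

(** The last letter always goes to the right, so a one-letter right factor forces all other letters
    to the left: a single unshuffle survives, with sign 1, and concatenation restores the word. *)
Lemma zcat_zcop w : zcat (zcop (hvec (tword w))) =
  if (1 < size w)%N then hvec (tword w) else 0.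
Proof.
have zl := zcat_linear.
rewrite /zcop (glift_gen (@zcop_respects K V)); cbv zeta.
rewrite sum_unshuff (lin_sum zl).
case/lastP: w => [|u c].
  by rewrite big_mkcond big_seq1.
have sE : size (degs (rcons u c)) = (size u + 1)%N.
  by rewrite size_map size_rcons addn1.
rewrite sE size_rcons /= big_mkcond masks_cat ltnS.
(* The last bit has to be false, which leaves a sum over the masks [b1] of the other letters and
   makes the upper bound on the number of set bits automatic. *)
pose F b1 : Tbar V := if (0 < count id b1)%N then
  ksign K (kexp (degs u) b1) *:
    zcat (tens (tword (mask b1 u)) (tword (rcons (rmask b1 u) c))) else 0.
rewrite (eq_big_seq F); last first.
  move=> b1 /size_masks sb; rewrite big_cons big_seq1 /=.
  rewrite !nth_cat sb ltnn subnn /= andbF add0r andbT count_cat /= !addn0.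
  rewrite ltnS -sb count_size andbT /F; case: ifP => // _; rewrite (linZ zl).
  rewrite -cats1 /degs map_cat kexp_cat ?size_map //= big_nil !mulr0 !addr0.
  by rewrite mask_cat // /rmask map_cat mask_cat ?size_map //= cats0 cats1.
(* Any mask other than the all-true one leaves a right word of at least two letters, which [zcat]
   kills. *)
rewrite (eq_big_seq (fun b => if all id b then F b else 0)); last first.
  move=> b /size_masks sb; case: ifP => // /negbT nb; rewrite /F zcat_tword.
  have := size_mask_rmask sb; rewrite size_mask //.
  move: nb; rewrite all_count; case: (rmask b u) => [|x [|y r]] /=.
  - by move=> /eqP nb; rewrite addn0 -sb.
  - by rewrite scaler0 if_same.
  - by rewrite scaler0 if_same.
rewrite -big_mkcond masks_all /F kexp_true count_nseq mul1n ksign0.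
rewrite scale1r zcat_tword /rmask map_nseq mask_false /= mask_true //.
by case: (u).
Qed.

End Concatenation.
Lemma glift_scale (K : fieldType) (P : presentation K) (M : lmodType K) a
    (F G : gens P -> M) x :
  (forall t, F t = a *: G t) -> glift F x = a *: glift G x.
Proof.
move=> E; rewrite /glift !fglift_sum scaler_sumr.
by apply: eq_bigr => t _; rewrite E !scalerA mulrC.
Qed.

Lemma glift_ext (K : fieldType) (P : presentation K) (M : lmodType K)
    (F G : gens P -> M) x : F =1 G -> glift F x = glift G x.
Proof.
by move=> E; rewrite -[RHS]scale1r; apply: glift_scale => t; rewrite scale1r E.
Qed.

Section OneLetter.
Variables (K : fieldType) (V : gradedLmodType K) (cop : V -> tensor V V).
Hypothesis cop_linear : linear cop.

Lemma ccopA1 (x : helt V) : ccopA cop [:: x] = 0.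
Proof. by rewrite /ccopA big_geq. Qed.

Lemma flip0 (U U' : gradedLmodType K) : flip (0 : tensor U U') = 0.
Proof. exact: (lin0 (glift_linear (@flip_respects K U U'))). Qed.

(** The terms of [ccopA] split a letter other than the last one, so on one letter only [ccopB]
    remains, with an empty prefix. *)
Lemma ccop_letter (x : helt V) : ccop cop (hvec (tword [:: x])) =
  @glift K (tensor_pres V V) _
    (fun p => tens (tword [:: p.1]) (tword [:: p.2])) (cop (hvec x)).
Proof.
rewrite /ccop (glift_gen (ccop_respects cop_linear)) ccopA1 flip0 subrr add0r.
rewrite /= big_nat1 /unshuff /= big_mkcond big_seq1 /= scale1r.
rewrite {1}/word_deg big_nil scale1r; apply: glift_ext => p.
by rewrite /word_deg big_nil mul0r scale1r.
Qed.

Lemma letters_respects : @respects K (tensor_pres V V) _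
  (fun p => tens (tword [:: p.1]) (tword [:: p.2])).
Proof.
apply: (tensor_respects (f := fun x y => tens (tword [:: x]) (tword [:: y])))
  => a x y z w xz yz zE.
  exact: (tens_wordl (@hdeg_tword K V) (@tword_multilinear K V) [::] [::]).
exact: (tens_wordr (@hdeg_tword K V) (@tword_multilinear K V) [::] [::]).
Qed.

Lemma word_deg_mask (w : seq (helt V)) b : size b = size w ->
  word_deg (mask b w) + word_deg (rmask b w) = word_deg w.
Proof.
elim: b w => [|c b IH] [|x w] //=; first by rewrite /word_deg !big_nil.
by move=> [/IH]; rewrite word_deg_cons => <-; case: c => /=;
  rewrite /rmask /= !word_deg_cons; ring.
Qed.

Lemma tword_scale a u (x z : helt V) v :
  hdeg x = hdeg z -> hvec z = a *: hvec x ->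
  hvec (tword (u ++ z :: v)) = a *: hvec (tword (u ++ x :: v)).
Proof.
move=> xz zE; have y0 : hvec (hcomp (hdeg z) 0 : helt V) = 0.
  by rewrite hvec_hcomp linear0.
have E := @tword_multilinear K V a u x (hcomp (hdeg z) 0) z v xz erefl.
by rewrite E ?y0 ?addr0 // (tword_zero _ _ y0) addr0.
Qed.

Lemma sword_move u x m r : hvec (sword (u ++ x :: m ++ r)) =
  ksign K (hdeg x * \sum_(e <- degs m) e) *:
    hvec (sword (u ++ m ++ x :: r)) :> Sbar V.
Proof.
elim: m u => [|y m IH] u /=; first by rewrite big_nil mulr0 scale1r.
rewrite sword_sym -cat_rcons IH cat_rcons scalerA -ksignD big_cons.
congr (ksign K _ *: _).
by ring.
Qed.

(** Each letter sent to the right is moved past the later letters sent to the left, and [kexp]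
    collects exactly the resulting signs. *)
Lemma sword_unshuffle u w b : size b = size w -> hvec (sword (u ++ w)) =
  ksign K (kexp (degs w) b) *: hvec (sword (u ++ mask b w ++ rmask b w)) :> Sbar V.
Proof.
elim: b w u => [|c b IH] [|x w] u //=; first by rewrite scale1r.
move=> [sb]; case: c; rewrite -cat_rcons IH // cat_rcons ksignD -scalerA.
  by rewrite scale1r.
by rewrite sword_move !scalerA -map_mask mulrC.
Qed.

End OneLetter.

Lemma masks_none (R : nmodType) n (F : bitseq -> R) :
  \sum_(b <- masks n | ~~ has id b) F b = F (nseq n false).
Proof.
elim: n F => [|n IH] F /=; first by rewrite big_mkcond big_seq1.
rewrite big_cat !big_map /= IH (eq_bigl (fun=> false)) // big_pred0_eq.
exact: add0r.
Qed.

Lemma masks_const (K : fieldType) (M : lmodType K) n (x : M) :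
  \sum_(b <- masks n) x = (2 ^+ n : K) *: x.
Proof.
elim: n => [|n IH]; first by rewrite big_seq1 scale1r.
rewrite /= big_cat !big_map /= IH exprS.
by rewrite -scalerDl mulr_natl mulr2n.
Qed.

(** The excluded masks are the all-true and the all-false one; they differ because [n] is positive,
    hence the [2]. *)
Lemma masks_proper (K : fieldType) (M : lmodType K) n (x : M) : (0 < n)%N ->
  \sum_(b <- masks n | (0 < count id b < n)%N) x = (2 ^+ n - 2 : K) *: x.
Proof.
move=> n0; rewrite scalerBl -masks_const.
have -> : (2 : K) *: x = \sum_(b <- masks n | all id b) x +
    \sum_(b <- masks n | ~~ has id b) x.
  by rewrite masks_all masks_none scaler_nat mulr2n.
have mk P : \sum_(b <- masks n | P b) x = \sum_(b <- masks n) if P b then x else 0.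
  by rewrite big_mkcond.
apply/eqP; rewrite eq_sym subr_eq (mk (all id)) (mk (fun b => ~~ has id b)).
rewrite (mk (fun b => 0 < count id b < n)%N) -!big_split; apply/eqP.
apply: eq_big_seq => b /size_masks sb /=; rewrite all_count has_count sb.
have := count_size id b; rewrite sb; case: (ltngtP (count id b) n) => //= cn _.
  by case: posnP => _; rewrite ?add0r ?addr0.
by rewrite cn n0 add0r addr0.
Qed.

Lemma eqr_nat_pchar0 (K : fieldType) m n : [pchar K] =i pred0 ->
  (m%:R == n%:R :> K) = (m == n).
Proof.
move=> /pcharf0P char0; wlog mn : m n / (m <= n)%N => [H|].
  by case/orP: (leq_total m n) => /H // E; rewrite eq_sym E eq_sym.
by rewrite eq_sym -subr_eq0 -natrB // char0 subn_eq0 eqn_leq mn.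
Qed.

(** * Recovering a letter from its unshuffle coproduct *)

Section SymmetricProduct.
Variables (K : fieldType) (V : gradedLmodType K).
Local Notation W := (shift (Sbar V)).
Implicit Types (w : seq (helt V)) (ws : seq (seq (helt V))).

(* The unshuffle coproduct followed by the product is 2^n - 2 on words of
   length n. *)
Definition sletter w1 w2 : Tbar W :=
  if nilp w1 || nilp w2 then 0 else
  (2 ^+ size (w1 ++ w2) - 2)^-1 *: hvec (bword [:: w1 ++ w2]).

Lemma bword1_multilinear : multilinear (fun w => hvec (bword [:: w])).
Proof.
move=> a u x y z v xz yz zE; rewrite /bword /=.
apply: (@tword_multilinear K W a [::] _ _ _ [::]).
- by rewrite !hdeg_letter (word_deg_mid _ _ xz).
- by rewrite !hdeg_letter (word_deg_mid _ _ yz).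
by rewrite !hvec_letter (sword_multilinear u v xz yz zE).
Qed.

Lemma bword1_sym u v (x y : helt V) :
  hvec (bword [:: u ++ x :: y :: v]) =
  ksign K (hdeg x * hdeg y) *: hvec (bword [:: u ++ y :: x :: v]).
Proof.
apply: (@tword_scale K W _ [::] _ _ [::]); rewrite ?hdeg_letter.
  by congr (_ + _); rewrite !word_deg_cat !word_deg_cons [hdeg y + _]addrCA.
by rewrite !hvec_letter sword_sym.
Qed.

Lemma nilp_mid (T : Type) u (x : T) v : nilp (u ++ x :: v) = false.
Proof. by case: u. Qed.

Lemma sletterl_multilinear w : multilinear (fun u => sletter u w).
Proof.
move=> a u x y z v xz yz zE; rewrite /sletter !nilp_mid /=.
case: nilp; first by rewrite scaler0 addr0.
rewrite -!catA /= (bword1_multilinear u (v ++ w) xz yz zE) !size_cat /=.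
by rewrite scalerDr !scalerA mulrC.
Qed.

Lemma sletterr_multilinear w : multilinear (sletter w).
Proof.
move=> a u x y z v xz yz zE; rewrite /sletter !nilp_mid /= orbF.
case: nilp; first by rewrite scaler0 addr0.
rewrite !catA /= (bword1_multilinear (w ++ u) v xz yz zE) !size_cat /=.
by rewrite scalerDr !scalerA mulrC.
Qed.

Lemma sletterr_respects w : @respects K (sbar_pres V) _ (sletter w).
Proof.
apply: sbar_respects (sletterr_multilinear w) _.
  by rewrite /sletter orbT.
move=> u x y v; rewrite /sletter !nilp_mid orbF; case: nilp.
  by rewrite scaler0.
by rewrite !catA bword1_sym !size_cat /= !scalerA mulrC.
Qed.

Definition sprod (p q : Sbar V) : Tbar W :=
  @glift K (sbar_pres V) _ (fun w1 => @glift K (sbar_pres V) _ (sletter w1) q) p.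

Lemma sprodl_respects q : @respects K (sbar_pres V) _
  (fun w1 => @glift K (sbar_pres V) _ (sletter w1) q).
Proof.
apply: sbar_respects => [|a u x y z v xz yz zE|u x y v].
- have := @glift_scale K (sbar_pres V) (Tbar W) 0 (sletter [::]) (sletter [::]) q.
  by rewrite scale0r; apply => t; rewrite scale0r.
- by apply: glift_lin => t; apply: sletterl_multilinear.
- apply: glift_scale => t; rewrite /sletter !nilp_mid /=; case: nilp.
    by rewrite scaler0.
  by rewrite -!catA bword1_sym !size_cat /= !scalerA mulrC.
Qed.

Lemma sprod_linearl q : linear (sprod^~ q).
Proof. exact: glift_linear (sprodl_respects q). Qed.

Lemma sprod_linearr p : linear (sprod p).
Proof.
move=> a x y; apply: glift_lin => t.
by rewrite (glift_linear (sletterr_respects t)).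
Qed.

Lemma sprod_sword w1 w2 :
  sprod (hvec (sword w1)) (hvec (sword w2)) = sletter w1 w2.
Proof.
rewrite /sprod (glift_gen (sprodl_respects _)).
by rewrite (glift_gen (sletterr_respects _)).
Qed.

(** The counterpart of [zcat] for [ccop]: both factors are projected to single letters and
    multiplied. The sign undoes the one that [scop] creates by moving a shift past the left
    factor. *)
Definition scat (t : tensor (Tbar W) (Tbar W)) : Tbar W :=
  @glift K (tensor_pres _ _) _ (fun p => ksign K (hdeg p.1 - 1) *:
    sprod (unsh (tproj (hvec p.1))) (unsh (tproj (hvec p.2)))) t.

Lemma scat_respects : @respects K (tensor_pres (Tbar W) (Tbar W)) _
  (fun p => ksign K (hdeg p.1 - 1) *:
    sprod (unsh (tproj (hvec p.1))) (unsh (tproj (hvec p.2)))).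
Proof.
apply: (tensor_respects (f := fun x y => ksign K (hdeg x - 1) *:
    sprod (unsh (tproj (hvec x))) (unsh (tproj (hvec y)))))
  => a x y z w xz yz ->; rewrite tproj_linear.
  rewrite [unsh _](@unsh_linear K _) sprod_linearl xz yz.
  by rewrite scalerDr !scalerA mulrC.
by rewrite [unsh (_ + _)](@unsh_linear K _) sprod_linearr scalerDr !scalerA mulrC.
Qed.

Lemma scat_linear : linear scat.
Proof. exact: glift_linear scat_respects. Qed.

Lemma tproj_bword ws : tproj (hvec (bword ws)) =
  if ws is [:: w] then sh (hvec (sword w)) else 0.
Proof.
rewrite /tproj (glift_gen (@tproj_respects K W)).
by case: ws => [|w [|? ?]] //; rewrite -hvec_letter.
Qed.

Lemma word_deg1 (U : gradedLmodType K) (x : helt U) : word_deg [:: x] = hdeg x.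
Proof. by rewrite /word_deg big_seq1. Qed.

Lemma scat_bword ws1 ws2 : scat (tens (bword ws1) (bword ws2)) =
  if (ws1, ws2) is ([:: w1], [:: w2]) then ksign K (word_deg w1) *: sletter w1 w2
  else 0.
Proof.
rewrite /scat (glift_gen scat_respects).
rewrite [X in _ *: X](_ : _ = sprod (unsh (tproj (hvec (bword ws1))))
  (unsh (tproj (hvec (bword ws2))))) // !tproj_bword.
have l0 q : sprod (unsh 0) q = 0 by exact: lin0 (sprod_linearl q).
have r0 p : sprod p (unsh 0) = 0 by exact: lin0 (sprod_linearr p).
case: ws1 => [|w1 [|? ws1]]; rewrite ?l0 ?scaler0 //.
case: ws2 => [|w2 [|? ws2]]; rewrite ?r0 ?scaler0 //.
by rewrite sprod_sword hdeg_tword word_deg1 hdeg_letter addrK.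
Qed.

(** If [ws] does not have exactly one letter, no term of the coproduct has a single letter in both
    factors. On one letter of length n, the 2^n - 2 proper unshuffles all contribute the same
    multiple of the word, which the factor in [sletter] normalises. *)
Lemma scat_ccop (charK : [pchar K] =i pred0) ws : nonnil ws ->
  scat (ccop (@scop K V) (hvec (bword ws))) =
  if ws is [:: w] then (if (1 < size w)%N then hvec (bword [:: w]) else 0) else 0.
Proof.
move=> nn; have [s1|s1] := eqVneq (size ws) 1%N; last first.
  rewrite (ccop_wt0 scat_linear) //; first by case: ws s1 nn => [|? [|? ?]].
  move=> ws1 ws2 /andP [g1 _] /andP [g2 _] _ sE; rewrite scat_bword.
  case: ws1 ws2 g1 g2 sE => [|w1 [|? ?]] [|w2 [|? ?]] //= _ _.
  by case: ws s1 {nn} => [|? [|? ?]].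
case: ws s1 nn => [|w [|? ?]] // _ _.
have sl := scat_linear.
rewrite (ccop_letter (@scop_linear K V)) glift_scop; last first.
  exact: letters_respects.
rewrite (lin_sum sl).
rewrite (eq_bigr (fun i => unshuff i xpredT (degs w) (fun b =>
  sletter (mask b w) (rmask b w)))); last first.
  move=> i _; rewrite (lin_unshuff sl); apply: eq_bigr => b _; congr (_ *: _).
  by rewrite (linZ sl) [scat _](scat_bword [:: _] [:: _]) scale_ksignK.
rewrite sum_unshuff size_map.
pose c : K := 2 ^+ size w - 2.
rewrite (eq_bigl (fun b => 0 < count id b < size w)%N); last first.
  by move=> b; rewrite andbT.
(* By [sword_unshuffle] the Koszul sign of the mask is the one that turns the reassembled word back
   into [w]. *)
rewrite big_seq_cond (eq_bigr (fun=> c^-1 *: hvec (bword [:: w]))); last first.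
  move=> b /andP [/size_masks sb] /andP [b0 bw].
  have sm := size_mask_rmask sb; have s1 := size_mask sb.
  have nE (r : seq (helt V)) : nilp r = ~~ (0 < size r)%N by rewrite -eqn0Ngt.
  rewrite /sletter !nE.
  rewrite (_ : _ || _ = false); last by apply/negbTE; rewrite negb_or !negbK; lia.
  rewrite size_cat sm scalerA mulrC -scalerA; congr (_ *: _).
  apply/esym/(@tword_scale K W _ [::] _ _ [::]); rewrite ?hdeg_letter.
    by rewrite word_deg_cat word_deg_mask.
  by rewrite !hvec_letter (sword_unshuffle [::] sb).
rewrite -big_seq_cond.
case: ifP => [w1|/negbT w1]; last first.
  by rewrite big_pred0 // => b; apply/negbTE; lia.
rewrite masks_proper ?(ltnW w1) // scalerA mulfV ?scale1r //.
(* In characteristic zero 2^n differs from 2 as soon as n > 1. *)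
rewrite /c subr_eq0 -natrX eqr_nat_pchar0 //.
by rewrite -[X in _ == X]expn1 eqn_exp2l // gtn_eqF.
Qed.

(** Letters carry a degree, so only one component of [v] is used: [d] is the degree after the shift,
    whence [d - 1] in [V]. *)
Definition unit_letter d (v : V) : Tbar W :=
  hvec (bword [:: [:: hcomp (d - 1) v]]).

Lemma unit_letter_linear d : linear (unit_letter d).
Proof.
move=> a x y; apply: (bword1_multilinear [::] [::]) => //.
by rewrite !hvec_hcomp linearP.
Qed.

(** Words with at least two letters are restored by [zcat], single letters of length at least two by
    [scat], and single letters of length one by the projection to the cogenerators. Each of the
    three maps vanishes on the other two kinds. *)
Lemma bar_decomposition (charK : [pchar K] =i pred0) d y :
  gproj d y = gproj d (zcat (zcop y) + scat (ccop (@scop K V) y)) +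
    unit_letter d (sproj (unsh (tproj y))).
Proof.
have tl : linear (@tproj K W) := @tproj_linear K W.
have pl : linear (@sproj K V) by exact: glift_linear (@sproj_respects K V).
have zl := @zcat_linear K W.
have zcl : linear (@zcop K W) by exact: glift_linear (@zcop_respects K W).
have ccl : linear (ccop (@scop K V)).
  exact: glift_linear (ccop_respects (@scop_linear K V)).
have ul := unit_letter_linear d.
move: y; apply: bword_ext.
- exact: linearP.
- apply: linear_add.
    apply: (linear_comp (f := gproj d)); first exact: linearP.
    by apply: linear_add; apply: linear_comp => //; exact: scat_linear.
  apply: (linear_comp ul); apply: (linear_comp pl).
  by apply: (linear_comp (@unsh_linear K _)).
move=> ws /andP [s0 nn].
rewrite [zcat _]zcat_zcop scat_ccop // tproj_bword size_map.
have p0 : sproj (unsh (0 : W)) = 0 by exact: (lin0 pl).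
case: ws s0 nn => [|w [|w' ws]] // _; last by rewrite p0 (lin0 ul) !addr0.
rewrite /nonnil /= andbT add0r /sproj (glift_gen (@sproj_respects K V)).
case: w => [|x [|x' w]] // _; last by rewrite (lin0 ul) addr0.
rewrite linear0 add0r gproj_hvec hdeg_tword word_deg1 hdeg_letter word_deg1.
rewrite /unit_letter; case: eqP => [<-|nd]; first by rewrite addrK hcomp_hvec.
rewrite [hcomp _ _](_ : _ = hcomp (d - 1) 0); first by rewrite [RHS](lin0 ul).
apply: helt_ext; rewrite // !hvec_hcomp gproj_hvec linear0.
by case: eqP => // xd; case: nd; rewrite xd subrK.
Qed.

Lemma primitive_eq0 (charK : [pchar K] =i pred0) d y :
  homog d y -> zcop y = 0 -> ccop (@scop K V) y = 0 ->
  sproj (unsh (tproj y)) = 0 -> y = 0.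
Proof.
move=> /eqP hy z0 c0 p0; rewrite -hy bar_decomposition // z0 c0 p0.
rewrite (lin0 (@zcat_linear K W)) (lin0 scat_linear).
by rewrite (lin0 (unit_letter_linear d)) !addr0 linear0.
Qed.

End SymmetricProduct.

(** * Squares of coderivations on the bar coalgebra *)

Section Bar.
Variables (K : fieldType) (g : gradedLmodType K).
Implicit Types (ws : seq (seq (helt (shift g)))).

Lemma bar_primitive_eq0 (charK : [pchar K] =i pred0) d (y : bar g) :
  homog d y -> bar_zcop y = 0 -> bar_ccop y = 0 -> bar_proj y = 0 -> y = 0.
Proof.
move=> hy z0 c0 p0; apply: (primitive_eq0 charK hy z0 c0).
by move: p0; rewrite /bar_proj /letter_proj => -[].
Qed.

Section Weights.
Variables (M : lmodType K) (G : tensor (bar g) (bar g) -> M).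
Hypothesis Gl : linear G.

Lemma bar_zcop_wt0 ws : nonnil ws ->
  (forall ws1 ws2, good ws1 -> good ws2 -> (wt ws1 + wt ws2)%N = wt ws ->
     G (tens (bword ws1) (bword ws2)) = 0) ->
  G (bar_zcop (hvec (bword ws))) = 0.
Proof. by move=> nn G0; apply: (@zcop_wt0 K (shift g) M G Gl ws nn G0). Qed.

Lemma bar_ccop_wt0 ws : nonnil ws ->
  (forall ws1 ws2, good ws1 -> good ws2 -> (wt ws1 + wt ws2)%N = wt ws ->
     (size ws1 + size ws2)%N = (size ws).+1 ->
     G (tens (bword ws1) (bword ws2)) = 0) ->
  G (bar_ccop (hvec (bword ws))) = 0.
Proof. by move=> nn G0; apply: (@ccop_wt0 K (shift g) M G ws Gl nn G0). Qed.

End Weights.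

Lemma bar_eq0 (M : lmodType K) (f : bar g -> M) : linear f ->
  (forall ws, good ws -> f (hvec (bword ws)) = 0) -> forall x, f x = 0.
Proof. by move=> fl f0; apply: (@bword_eq0 K (shift g) M f fl f0). Qed.

Lemma bar_ext (M : lmodType K) (f h : bar g -> M) : linear f -> linear h ->
  (forall ws, good ws -> f (hvec (bword ws)) = h (hvec (bword ws))) -> f =1 h.
Proof. by move=> fl hl fh; apply: (@bword_ext K (shift g) M f h fl hl fh). Qed.

Lemma bar_zcop_linear : linear (@bar_zcop K g).
Proof. exact: glift_linear (@zcop_respects K _). Qed.

Lemma bar_ccop_linear : linear (@bar_ccop K g).
Proof. exact: glift_linear (ccop_respects (@scop_linear K _)). Qed.

End Bar.

Section CofreeSquare.
Variables (K : fieldType) (charK : [pchar K] =i pred0) (g : gradedLmodType K).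
Variable D : bar g -> bar g.
Hypothesis cD : coderivation (-1) D.

Lemma good_wt (V : gradedLmodType K) (ws : seq (seq (helt V))) :
  good ws -> (0 < wt ws)%N.
Proof.
case: ws => [|w ws] // /andP [_ /= /andP [w0 _]].
by rewrite wt_cons addn_gt0 w0.
Qed.

Lemma coder_square_eq0 :
  (forall x, bar_proj (D (D x)) = 0) -> forall x, D (D x) = 0.
Proof.
move=> DD0; have DDl : linear (fun x => D (D x)).
  by apply: linear_comp; exact: coder_linear cD.
apply: (bar_eq0 DDl) => ws gws; have [n wn] := ubnP (wt ws).
elim: n ws gws wn => // n IH ws gws wn; have /andP [_ nn] := gws.
(* Both weights are positive and add up to that of [ws], so the induction hypothesis kills both
   terms. *)
have T0 ws1 ws2 : good ws1 -> good ws2 -> (wt ws1 + wt ws2)%N = wt ws ->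
    tens_deriv (-2) (fun x => D (D x)) (tens (bword ws1) (bword ws2)) = 0.
  move=> g1 g2 wE; have w1 := good_wt g1; have w2 := good_wt g2.
  have D0 d ws' : good ws' -> (wt ws' < wt ws)%N ->
      hvec (hcomp d (D (D (hvec (bword ws')))) : helt (bar g)) = 0.
    by move=> g' w'; rewrite IH ?hvec_hcomp ?linear0 //; lia.
  rewrite tens_deriv_tens // tens0l ?[X in _ *: X]tens0r ?D0 //; try by lia.
  by rewrite scaler0 addr0.
have Tl := tens_deriv_linear (-2) DDl.
have h1 := coder_degree cD (homog_hvec (bword ws : helt (bar g))).
have h2 := coder_degree cD h1.
apply: (bar_primitive_eq0 charK h2); last exact: DD0.
- by rewrite coder_square_zcop //; apply: (bar_zcop_wt0 Tl nn T0).
- rewrite coder_square_ccop //; apply: (bar_ccop_wt0 Tl nn) => ws1 ws2 g1 g2 wE _.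
  exact: T0.
Qed.

End CofreeSquare.

(** * The corestrictions of the two brackets on words *)

Section Corestriction.
Variables (K : fieldType) (g : gradedLmodType K).
Implicit Types (w : seq (helt (shift g))) (ws : seq (seq (helt (shift g)))).

Definition base (a : helt (shift g)) : g := unsh (hvec a).

Lemma homog_base a : homog (hdeg a - 1) (base a).
Proof. by apply/eqP; exact: unsh_hvec. Qed.

(* The projection to the cogenerators and, below, the corestriction of dLie +
   dLeib, both with the two suspensions removed. *)
Definition bproj (x : bar g) : g := unsh (unsh (bar_proj x)).

Lemma bproj_linear : linear bproj.
Proof.
move=> a x y; rewrite /bproj /bar_proj (@tproj_linear K _).
by rewrite (@letter_proj_linear K g).
Qed.

Lemma letter_proj_letter w :
  letter_proj (hvec (letter w)) = if w is [:: a] then sh (hvec a) else 0.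
Proof.
rewrite hvec_letter /letter_proj /sproj (glift_gen (@sproj_respects K _)).
by case: w => [|? [|? ?]].
Qed.

Lemma bproj_bword ws :
  bproj (hvec (bword ws)) = if ws is [:: [:: a]] then base a else 0.
Proof.
rewrite /bproj /bar_proj tproj_bword; case: ws => [|w [|? ?]].
- by rewrite (lin0 (@letter_proj_linear K g)).
- by rewrite -hvec_letter letter_proj_letter; case: w => [|? [|? ?]].
- by rewrite (lin0 (@letter_proj_linear K g)); case: w => [|? [|? ?]].
Qed.

Lemma desuspend2_tens (V : gradedLmodType K) (x y : helt (shift V)) :
  desuspend2 (tens x y) = ksign K (hdeg x) *:
    tens (hcomp (hdeg x - 1) (unsh (hvec x))) (hcomp (hdeg y - 1) (unsh (hvec y))).
Proof.
rewrite /desuspend2 (tens_map_tens _ _ _ _ (@unsh_linear K V) (@unsh_linear K V)).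
by rewrite mulN1r ksignN.
Qed.

Section Bracket.
Variable b : {bilinear g -> g -> g}.

Lemma tens_eval_linear : linear (tens_eval b).
Proof. exact: glift_linear (@tens_eval_respects _ _ _ b). Qed.

Lemma tens_eval_tens x y : tens_eval b (tens x y) = b (hvec x) (hvec y).
Proof. exact: glift_gen (@tens_eval_respects _ _ _ b) (x, y). Qed.

(** The sign comes from moving the second desuspension past the first letter. *)
Lemma lie_corestriction_bword ws :
  bracket_degree 0 b -> graded_antisymmetric b ->
  unsh (unsh (lie_corestriction b (hvec (bword ws)))) =
  if ws is [:: [:: x; y]] then ksign K (hdeg x) *: b (base x) (base y) else 0.
Proof.
move=> bd ba; rewrite /lie_corestriction tproj_bword.
have hr := lie_corestriction_respects bd ba.
have h0 := lin0 (glift_linear hr).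
case: ws => [|w [|w' ws]]; rewrite ?h0 //; last by case: w => [|? [|? [|? ?]]].
rewrite (glift_gen hr); case: w => [|x [|y [|? ?]]] //=.
rewrite desuspend2_tens (linZ tens_eval_linear) tens_eval_tens !hvec_hcomp.
by rewrite !unsh_hvec.
Qed.

(** The two desuspensions of the second factor pass the first factor in degrees that differ by one,
    so their signs multiply to [-1]. *)
Lemma leib_corestriction_bword ws :
  unsh (unsh (leib_corestriction b (hvec (bword ws)))) =
  if ws is [:: [:: x]; [:: y]] then - b (base x) (base y) else 0.
Proof.
rewrite /leib_corestriction (glift_gen (leib_corestriction_respects b)).
case: ws => [|w1 [|w2 [|w3 ws]]]; last by case: w1 w2 => [|? [|? ?]] [|? [|? ?]].
- by [].
- by case: w1 => [|? [|? ?]].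
cbn beta iota delta [map].
rewrite (tens_map_tens _ _ _ _ (@letter_proj_linear K g) (@letter_proj_linear K g)).
rewrite mul0r scale1r !desuspend2_tens !addr0 !letter_proj_letter.
rewrite (linZ (@desuspend2_linear K g)) desuspend2_tens !(linZ tens_eval_linear).
rewrite tens_eval_tens !hdeg_hcomp.
(* What remains of one factor after the projection to [s s g] and both desuspensions, each followed
   by a projection to its degree. *)
pose R w := hvec (hcomp (word_deg w + 1 - 1 - 1) (unsh (hvec
  (hcomp (word_deg w + 1 - 1) (unsh (hvec (hcomp (word_deg w + 1)
    (if w is [:: a] then sh (hvec a) else (0 : shift (shift g)))))))))).
have RE w : R w = if w is [:: a] then base a else 0.
  rewrite /R; case: w => [|x [|y w]].
  - rewrite !hvec_hcomp linear0 [unsh 0]/(0 : shift g) linear0.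
    by rewrite [unsh 0]/(0 : g) linear0.
  - rewrite word_deg1 !addrK.
    have -> : hvec (hcomp (hdeg x + 1) (sh (hvec x) : shift (shift g))) =
        sh (hvec (hcomp (hdeg x + 1 - 1) (hvec x))) by [].
    by rewrite addrK !hcomp_hvec hvec_hcomp unsh_hvec.
  - rewrite !hvec_hcomp linear0 [unsh 0]/(0 : shift g) linear0.
    by rewrite [unsh 0]/(0 : g) linear0.
rewrite -/(R w1) -/(R w2) !RE /=.
case: w1 => [|x [|x' w1]]; first by rewrite linear0l !scaler0.
  case: w2 => [|y [|y' w2]]; rewrite ?linear0r ?scaler0 //.
  rewrite word_deg1 addrK scalerA -ksignD -scaleN1r; congr (_ *: _).
  by rewrite addrAC ksignD ksignD ksign_sqr mul1r /ksign expr1z.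
by rewrite linear0l !scaler0.
Qed.
End Bracket.
End Corestriction.
(** * Coproducts of short words *)

Section SmallWords.
Variables (K : fieldType) (V : gradedLmodType K).

Lemma zcop_tword (w : seq (helt V)) : zcop (hvec (tword w)) =
  \sum_(1 <= i < size w)
    unshuff i (fun b => ~~ nth true b (size w).-1) (degs w)
      (fun b => tens (tword (mask b w)) (tword (rmask b w))).
Proof. exact: glift_gen (@zcop_respects K V) w. Qed.

Lemma zcop1 (x : helt V) : zcop (hvec (tword [:: x])) = 0.
Proof. by rewrite zcop_tword big_geq. Qed.

Lemma zcop2 (x y : helt V) :
  zcop (hvec (tword [:: x; y])) = tens (tword [:: x]) (tword [:: y]).
Proof.
rewrite zcop_tword sum_unshuff big_mkcond.
rewrite [masks _]/= !big_cons !big_nil [LHS]/= ?big_cons ?big_nil.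
by rewrite !(mulr0, addr0, add0r) scale1r.
Qed.

Lemma zcop3 (x y z : helt V) : zcop (hvec (tword [:: x; y; z])) =
  tens (tword [:: x]) (tword [:: y; z]) +
  ksign K (hdeg x * hdeg y) *: tens (tword [:: y]) (tword [:: x; z]) +
  tens (tword [:: x; y]) (tword [:: z]).
Proof.
rewrite zcop_tword sum_unshuff big_mkcond.
rewrite [masks _]/= !big_cons !big_nil [LHS]/= ?big_cons ?big_nil.
rewrite !(mulr0, addr0, add0r) !scale1r.
by rewrite [LHS]addrC.
Qed.

Variable cop : V -> tensor V V.
Hypothesis cop_linear : linear cop.

Lemma ccopA2 (x y : helt V) : ccopA cop [:: x; y] =
  @glift K (tensor_pres V V) _
    (fun p => tens (tword [:: p.1; p.2]) (tword [:: y])) (cop (hvec x)).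
Proof.
rewrite /ccopA.
rewrite !big_nat1 /unshuff big_mkcond [masks _]/= !big_cons !big_nil [LHS]/=.
by rewrite big_nil mulr0 !addr0 add0r scale1r {1}/word_deg big_nil scale1r.
Qed.

Lemma cons_right_respects (x : helt V) : @respects K (tensor_pres V V) _
  (fun p => ksign K (hdeg x * hdeg p.1) *:
     tens (tword [:: p.1]) (tword [:: x; p.2])).
Proof. by have := @ccopB_letters_respects K V [::] [:: x]; rewrite word_deg1. Qed.

Lemma cons_left_respects (x : helt V) : @respects K (tensor_pres V V) _
  (fun p => tens (tword [:: x; p.1]) (tword [:: p.2])).
Proof.
apply: (tensor_respects (f := fun y z => tens (tword [:: x; y]) (tword [:: z])))
  => a y z t w yt zt tE.
  exact: (tens_wordl (@hdeg_tword K V) (@tword_multilinear K V) [:: x] [::]).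
exact: (tens_wordr (@hdeg_tword K V) (@tword_multilinear K V) [::] [::]).
Qed.

Lemma ccopB2 (x y : helt V) : ccopB cop [:: x; y] =
  ksign K (hdeg x) *:
    (@glift K (tensor_pres V V) _ (fun p => ksign K (hdeg x * hdeg p.1) *:
      tens (tword [:: p.1]) (tword [:: x; p.2])) (cop (hvec y)) +
    @glift K (tensor_pres V V) _ (fun p =>
      tens (tword [:: x; p.1]) (tword [:: p.2])) (cop (hvec y))).
Proof.
rewrite /ccopB sum_unshuff big_mkcond [masks _]/= !big_cons !big_nil [LHS]/=.
rewrite big_nil mulr0 !addr0 !scale1r [RHS]scalerDr [RHS]addrC word_deg1.
congr (_ *: _ + _ *: _); apply: glift_ext => p; rewrite /rmask /=.
by rewrite /word_deg big_nil mul0r scale1r.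
Qed.
End SmallWords.

Section SmallLetters.
Variables (K : fieldType) (V : gradedLmodType K).
Implicit Types a b c : helt V.

Lemma scop1 a : scop (hvec (letter [:: a])) = 0.
Proof. by rewrite scop_letter big_geq. Qed.

Lemma scop2 a b : scop (hvec (letter [:: a; b])) =
  ksign K (hdeg a) *: tens (letter [:: a]) (letter [:: b]) +
  ksign K (hdeg a * hdeg b + hdeg b) *: tens (letter [:: b]) (letter [:: a]).
Proof.
rewrite scop_letter sum_unshuff big_mkcond [masks _]/= !big_cons !big_nil.
rewrite [LHS]/= ?big_cons ?big_nil.
rewrite !(mulr0, addr0, add0r) scale1r !word_deg1.
by rewrite scalerA -ksignD.
Qed.

Lemma scop3 a b c : scop (hvec (letter [:: a; b; c])) =
  ksign K (hdeg a + hdeg b) *: tens (letter [:: a; b]) (letter [:: c]) +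
  ksign K (hdeg b * hdeg c + hdeg a + hdeg c) *:
    tens (letter [:: a; c]) (letter [:: b]) +
  ksign K (hdeg a) *: tens (letter [:: a]) (letter [:: b; c]) +
  ksign K (hdeg a * (hdeg b + hdeg c) + hdeg b + hdeg c) *:
    tens (letter [:: b; c]) (letter [:: a]) +
  ksign K (hdeg a * hdeg b + hdeg b) *: tens (letter [:: b]) (letter [:: a; c]) +
  ksign K (hdeg a * hdeg c + hdeg b * hdeg c + hdeg c) *:
    tens (letter [:: c]) (letter [:: a; b]).
Proof.
rewrite scop_letter sum_unshuff big_mkcond [masks _]/= !big_cons !big_nil.
rewrite [LHS]/= ?big_cons ?big_nil.
rewrite /word_deg !big_cons !big_nil !(mulr0, addr0, add0r) !scale1r.
by rewrite !scalerA -!ksignD !addrA.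
Qed.

Local Notation W := (shift (Sbar V)).

Section Values.
Variables (M : lmodType K) (G : tensor (Tbar W) (Tbar W) -> M).
Hypothesis Gl : linear G.
Local Notation "ws1 '|~' ws2" := (G (tens (bword ws1) (bword ws2)))
  (at level 10, ws2 at next level).
Local Notation cop := (ccop (@scop K V)).

Lemma zcop_111 a b c : G (zcop (hvec (bword [:: [:: a]; [:: b]; [:: c]]))) =
  [:: [:: a]] |~ [:: [:: b]; [:: c]] +
  ksign K ((hdeg a + 1) * (hdeg b + 1)) *: [:: [:: b]] |~ [:: [:: a]; [:: c]] +
  [:: [:: a]; [:: b]] |~ [:: [:: c]].
Proof. by rewrite zcop3 !(linD Gl) (linZ Gl) !hdeg_letter !word_deg1. Qed.

Lemma ccop_1 w : G (cop (hvec (bword [:: w]))) =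
  G (@glift K (tensor_pres W W) _
    (fun p => tens (tword [:: p.1]) (tword [:: p.2])) (scop (hvec (letter w)))).
Proof. by rewrite (ccop_letter (@scop_linear K V)). Qed.

Let gl := linear_comp Gl (glift_linear (@letters_respects K W)).

Lemma ccop_2 a b : G (cop (hvec (bword [:: [:: a; b]]))) =
  ksign K (hdeg a) *: [:: [:: a]] |~ [:: [:: b]] +
  ksign K (hdeg a * hdeg b + hdeg b) *: [:: [:: b]] |~ [:: [:: a]].
Proof.
rewrite ccop_1 scop2 (linD gl) !(linZ gl).
by rewrite !(glift_gen (@letters_respects K W)).
Qed.

Lemma ccop_3 a b c : G (cop (hvec (bword [:: [:: a; b; c]]))) =
  ksign K (hdeg a + hdeg b) *: [:: [:: a; b]] |~ [:: [:: c]] +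
  ksign K (hdeg b * hdeg c + hdeg a + hdeg c) *: [:: [:: a; c]] |~ [:: [:: b]] +
  ksign K (hdeg a) *: [:: [:: a]] |~ [:: [:: b; c]] +
  ksign K (hdeg a * (hdeg b + hdeg c) + hdeg b + hdeg c) *:
    [:: [:: b; c]] |~ [:: [:: a]] +
  ksign K (hdeg a * hdeg b + hdeg b) *: [:: [:: b]] |~ [:: [:: a; c]] +
  ksign K (hdeg a * hdeg c + hdeg b * hdeg c + hdeg c) *:
    [:: [:: c]] |~ [:: [:: a; b]].
Proof.
rewrite ccop_1 scop3 !(linD gl) !(linZ gl).
by rewrite !(glift_gen (@letters_respects K W)).
Qed.

(** The last letter has zero coproduct, so [ccopB] vanishes; the terms are those of [ccopA] and,
    after the minus, of its flip. *)
Lemma ccop_21 a b c : G (cop (hvec (bword [:: [:: a; b]; [:: c]]))) =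
  ksign K (hdeg a) *: [:: [:: a]; [:: b]] |~ [:: [:: c]] +
  ksign K (hdeg a * hdeg b + hdeg b) *: [:: [:: b]; [:: a]] |~ [:: [:: c]] -
  ksign K ((hdeg a + hdeg b + 2) * (hdeg c + 1)) *:
    (ksign K (hdeg a) *: [:: [:: c]] |~ [:: [:: a]; [:: b]] +
     ksign K (hdeg a * hdeg b + hdeg b) *: [:: [:: c]] |~ [:: [:: b]; [:: a]]).
Proof.
rewrite /ccop (glift_gen (ccop_respects (@scop_linear K V))).
rewrite [map _ _]/= ccopA2 ccopB2 scop1 scop2.
have r1 := @ccopA_letters_respects K W [::] [::] [:: letter [:: c]].
have l1 := glift_linear r1.
have fl := glift_linear (@flip_respects K (Tbar W) (Tbar W)).
rewrite (linD l1) !(linZ l1) !(glift_gen r1) /flip (linD fl) !(linZ fl).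
rewrite !(glift_gen (@flip_respects K (Tbar W) (Tbar W))).
rewrite (lin0 (glift_linear (cons_right_respects _))).
rewrite (lin0 (glift_linear (cons_left_respects _))) addr0 scaler0 addr0.
rewrite (linD Gl) (linN Gl) !(linD Gl) !(linZ Gl).
congr (_ - _); rewrite scalerDr.
congr (_ + _); rewrite !scalerA -!ksignD !hdeg_tword !word_deg_cons !hdeg_letter;
  rewrite !word_deg1 /word_deg !big_nil; congr (ksign K _ *: _);
  by ring.
Qed.

(** The first letter has zero coproduct, so [ccopA] and its flip vanish; the sign in front moves the
    coproduct past the first letter, of degree [hdeg a + 1]. *)
Lemma ccop_12 a b c : G (cop (hvec (bword [:: [:: a]; [:: b; c]]))) =
  ksign K (hdeg a + 1) *:
  (ksign K (hdeg b + (hdeg a + 1) * (hdeg b + 1)) *: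
     [:: [:: b]] |~ [:: [:: a]; [:: c]] +
   ksign K (hdeg b * hdeg c + hdeg c + (hdeg a + 1) * (hdeg c + 1)) *:
     [:: [:: c]] |~ [:: [:: a]; [:: b]] +
   (ksign K (hdeg b) *: [:: [:: a]; [:: b]] |~ [:: [:: c]] +
    ksign K (hdeg b * hdeg c + hdeg c) *: [:: [:: a]; [:: c]] |~ [:: [:: b]])).
Proof.
rewrite /ccop (glift_gen (ccop_respects (@scop_linear K V))).
rewrite [map _ _]/= ccopA2 ccopB2 scop1 scop2.
have r1 := @ccopA_letters_respects K W [::] [::] [:: letter [:: b; c]].
rewrite (lin0 (glift_linear r1)) flip0 subr0 add0r.
have rr := @cons_right_respects K W (letter [:: a]); have lr := glift_linear rr.
have rl := @cons_left_respects K W (letter [:: a]); have ll := glift_linear rl.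
rewrite (linD lr) (linD ll) !(linZ lr) !(linZ ll) !(glift_gen rr) !(glift_gen rl).
rewrite !(linZ Gl) !(linD Gl) !(linZ Gl) !hdeg_letter !word_deg1.
by rewrite !scalerA -!ksignD.
Qed.

End Values.
End SmallLetters.
(* Replaces an identity of linear combinations of X, Y, Z by the identities of
   their coefficients, which the field tactic can handle. *)
Lemma combination3 (K : fieldType) (M : lmodType K) (X Y Z : M) :
  exists p : K -> K -> K -> M,
  [/\ [/\ p 1 0 0 = X, p 0 1 0 = Y & p 0 0 1 = Z], p 0 0 0 = 0,
      forall a b c a' b' c', p a b c + p a' b' c' = p (a + a') (b + b') (c + c'),
      forall k a b c, k *: p a b c = p (k * a) (k * b) (k * c) &
      forall a b c, - p a b c = p (- a) (- b) (- c)].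
Proof.
exists (fun a b c => a *: X + b *: Y + c *: Z); split.
- by rewrite !scale1r !scale0r !addr0 !add0r.
- by rewrite !scale0r !addr0.
- by move=> a b c a' b' c'; rewrite !scalerDl [LHS]addrACA; congr (_ + _);
    rewrite addrACA.
- by move=> k a b c; rewrite !scalerDr !scalerA.
- by move=> a b c; rewrite !opprD !scaleNr.
Qed.

(** * The square of the coderivation *)

(** The signs depend only on the parities of the three degrees, which leaves eight identities in the
    field. *)
Ltac ksign_field a b c :=
  rewrite ?ksignE ?(odd_abszD, odd_abszM) ?abszN;
  case: (odd (absz (hdeg a))); case: (odd (absz (hdeg b)));
  case: (odd (absz (hdeg c))); rewrite /= ?expr0 ?expr1; field.

Section Bracket.
Variables (K : fieldType) (charK : [pchar K] =i pred0) (g : gradedLmodType K).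
Variables (lie leib : {bilinear g -> g -> g}).
Hypotheses (lie_deg : bracket_degree 0 lie) (lie_anti : graded_antisymmetric lie)
  (leib_deg : bracket_degree 1 leib).
Implicit Types (a b c : helt (shift g)) (ws : seq (seq (helt (shift g)))).

Definition phi (x : bar g) : g :=
  unsh (unsh (lie_corestriction lie x + leib_corestriction leib x)).

Lemma phi_linear : linear phi.
Proof.
have ul (U : gradedLmodType K) := @unsh_linear K U.
apply: (linear_comp (ul _)); apply: (linear_comp (ul _)); apply: linear_add.
  apply: (linear_comp (glift_linear (lie_corestriction_respects lie_deg lie_anti))).
  by apply: (linear_comp (ul _)); exact: tproj_linear.
exact: glift_linear (leib_corestriction_respects leib).
Qed.

Lemma phi_bword ws : phi (hvec (bword ws)) =
  match ws with
  | [:: [:: a; b]] => ksign K (hdeg a) *: lie (base a) (base b)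
  | [:: [:: a]; [:: b]] => - leib (base a) (base b)
  | _ => 0
  end.
Proof.
have -> : phi (hvec (bword ws)) =
  unsh (unsh (lie_corestriction lie (hvec (bword ws)))) +
  unsh (unsh (leib_corestriction leib (hvec (bword ws)))) by [].
rewrite lie_corestriction_bword // leib_corestriction_bword.
by case: ws => [|[|a [|b [|? ?]]] [|[|? [|? ?]] [|? ?]]]; rewrite ?addr0 ?add0r.
Qed.

Definition pair_eval (b : g -> g -> g) (t : tensor (bar g) (bar g)) : g :=
  @glift K (tensor_pres (bar g) (bar g)) _
    (fun p => b (bproj (hvec p.1)) (bproj (hvec p.2))) t.

Lemma pair_eval_respects (b : {bilinear g -> g -> g}) :
  @respects K (tensor_pres (bar g) (bar g)) _
    (fun p => b (bproj (hvec p.1)) (bproj (hvec p.2))).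
Proof.
apply: (tensor_respects (f := fun x y => b (bproj (hvec x)) (bproj (hvec y))))
  => k x y z w _ _ ->; rewrite bproj_linear; first by rewrite linearPl.
by rewrite linearPr.
Qed.

Lemma pair_eval_linear (b : {bilinear g -> g -> g}) : linear (pair_eval b).
Proof. exact: glift_linear (pair_eval_respects b). Qed.

Lemma pair_eval_tens (b : {bilinear g -> g -> g}) x y :
  pair_eval b (tens x y) = b (bproj (hvec x)) (bproj (hvec y)).
Proof. exact: (glift_gen (pair_eval_respects b) (x, y)). Qed.

Lemma wt_eq0 ws : nonnil ws -> wt ws = 0%N -> ws = [::].
Proof.
case: ws => // w ws nn w0; have := @good_wt K (shift g) (w :: ws).
by rewrite w0 /good nn => /(_ isT).
Qed.

Lemma wt_eq1 ws : nonnil ws -> wt ws = 1%N -> exists a, ws = [:: [:: a]].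
Proof.
case: ws => [|[|a w] ws] //= nn [] /eqP; rewrite addn_eq0.
by move=> /andP [/nilP -> /eqP /(wt_eq0 nn) ->]; exists a.
Qed.

Lemma wt_eq2 ws : nonnil ws -> wt ws = 2%N ->
  (exists a b, ws = [:: [:: a; b]]) \/ (exists a b, ws = [:: [:: a]; [:: b]]).
Proof.
case: ws => [|[|a [|b w]] ws] //= nn [].
  by move=> /(wt_eq1 nn) [b ->]; right; exists a, b.
move=> /eqP; rewrite addn_eq0 => /andP [/nilP -> /eqP /(wt_eq0 nn) ->].
by left; exists a, b.
Qed.

Lemma wt_eq3 ws : nonnil ws -> wt ws = 3%N ->
  [\/ exists a b c, ws = [:: [:: a; b; c]],
     exists a b c, ws = [:: [:: a; b]; [:: c]],
     exists a b c, ws = [:: [:: a]; [:: b; c]] |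
     exists a b c, ws = [:: [:: a]; [:: b]; [:: c]]].
Proof.
case: ws => [|[|a [|b [|c w]]] ws] //= nn [].
- move=> /(wt_eq2 nn) [] [b [c ->]]; first by constructor 3; exists a, b, c.
  by constructor 4; exists a, b, c.
- by move=> /(wt_eq1 nn) [c ->]; constructor 2; exists a, b, c.
move=> /eqP; rewrite addn_eq0 => /andP [/nilP -> /eqP /(wt_eq0 nn) ->].
by constructor 1; exists a, b, c.
Qed.

Lemma size_wt ws : nonnil ws -> (size ws <= wt ws)%N.
Proof.
elim: ws => //= w ws IH /andP [w0 /IH]; rewrite wt_cons => nn.
by rewrite -add1n leq_add.
Qed.

Lemma bproj_wt ws : wt ws <> 1%N -> bproj (hvec (bword ws)) = 0.
Proof. by rewrite bproj_bword; case: ws => [|[|? [|? ?]] [|? ?]]. Qed.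

Lemma phi_wt ws : wt ws <> 2%N -> phi (hvec (bword ws)) = 0.
Proof.
by rewrite phi_bword; case: ws => [|[|? [|? [|? ?]]] [|[|? [|? ?]] [|? ?]]].
Qed.

Lemma two_neq0 : (2 : K) != 0.
Proof. by rewrite (eqr_nat_pchar0 2 0 charK). Qed.

Lemma lie_swap x y i j : homog i x -> homog j y ->
  lie y x = - (ksign K (i * j) *: lie x y).
Proof. by move=> hx hy; rewrite (lie_anti hy hx) mulrC. Qed.

Lemma pair_eval_bword (b : {bilinear g -> g -> g}) ws1 ws2 :
  pair_eval b (tens (bword ws1) (bword ws2)) =
  b (bproj (hvec (bword ws1))) (bproj (hvec (bword ws2))).
Proof. exact: pair_eval_tens. Qed.

(** On s(ab) the coproduct contains both orders of the letters, and antisymmetry makes their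
    contributions equal, hence the 1/2. On s(a) s(b) only [bar_zcop] contributes, and other words
    give zero by weight. *)
Lemma phi_coproducts x : phi x =
  2^-1 *: pair_eval lie (bar_ccop x) - pair_eval leib (bar_zcop x).
Proof.
rewrite -scaleN1r; move: x; apply: bar_ext.
- exact: phi_linear.
- apply: linear_add; apply: linear_scale; apply: linear_comp;
    [exact: pair_eval_linear|exact: bar_ccop_linear|
     exact: pair_eval_linear|exact: bar_zcop_linear].
move=> ws /andP [_ nn]; rewrite scaleN1r.
have [w2|w2] := eqVneq (wt ws) 2%N; last first.
  have p0 (b : {bilinear g -> g -> g}) ws1 ws2 : (wt ws1 + wt ws2)%N = wt ws ->
      pair_eval b (tens (bword ws1) (bword ws2)) = 0.
    move=> wE; rewrite pair_eval_bword.
    have [w1|w1] := eqVneq (wt ws1) 1%N; last first.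
      by rewrite (bproj_wt (elimN eqP w1)) linear0l.
    by rewrite (bproj_wt (ws := ws2)) ?linear0r //; lia.
  rewrite phi_wt; last exact/eqP.
  rewrite (bar_ccop_wt0 (pair_eval_linear lie) nn); last first.
    by move=> ws1 ws2 _ _ wE _; exact: p0.
  rewrite (bar_zcop_wt0 (pair_eval_linear leib) nn); last first.
    by move=> ws1 ws2 _ _ wE; exact: p0.
  by rewrite scaler0 subrr.
have [[a [b ->]]|[a [b ->]]] := wt_eq2 nn w2; last first.
  have -> : pair_eval leib (bar_zcop (hvec (bword [:: [:: a]; [:: b]]))) =
      leib (base a) (base b).
    transitivity (pair_eval leib (tens (bword [:: [:: a]]) (bword [:: [:: b]]))).
      by congr (pair_eval leib _); exact: zcop2.
    by rewrite pair_eval_bword !bproj_bword.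
  rewrite (bar_ccop_wt0 (pair_eval_linear lie)) //.
    by rewrite phi_bword scaler0 sub0r.
  (* The two words have three letters together, so one of the two projections vanishes. *)
  move=> ws1 ws2 _ _ _ sE; rewrite pair_eval_bword !bproj_bword.
  by case: ws1 ws2 sE => [|[|? [|? ?]] [|? ?]] [|[|? [|? ?]] [|? ?]] //=;
    rewrite ?linear0l ?linear0r.
have -> : pair_eval leib (bar_zcop (hvec (bword [:: [:: a; b]]))) = 0.
  rewrite -(lin0 (pair_eval_linear leib)); congr (pair_eval leib _).
  exact: zcop1.
have -> := @ccop_2 K (shift g) g (pair_eval lie) (pair_eval_linear lie) a b.
rewrite !pair_eval_bword !bproj_bword phi_bword.
rewrite (lie_swap (homog_base a) (homog_base b)).
have [p [[e1 _ _] p0 pD pZ pN]] := combination3 (lie (base a) (base b)) 0 0.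
(* Provides the side condition for dividing by [2] in [field]. *)
have n2 := two_neq0.
rewrite subr0 -e1 ?(pD, pZ, pN); congr p; try by ring.
by ksign_field a b b.
Qed.

Section Square.
Variable D : bar g -> bar g.
Hypotheses (cD : coderivation (-1) D) (bproj_D : forall x, bproj (D x) = phi x).

(** Projecting to the cogenerators turns [D] into [phi], so the right-hand side involves no explicit
    formula for [D]. *)
Lemma pair_eval_deriv (b : {bilinear g -> g -> g}) (x y : helt (bar g)) :
  pair_eval b (tens_deriv (-1) D (tens x y)) =
  b (phi (hvec x)) (bproj (hvec y)) +
  ksign K (hdeg x) *: b (bproj (hvec x)) (phi (hvec y)).
Proof.
rewrite tens_deriv_tens; last exact: coder_linear cD.
rewrite (linD (pair_eval_linear b)) (linZ (pair_eval_linear b)) !pair_eval_tens.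
by rewrite !(coder_hvec _ cD) !bproj_D mulN1r ksignN.
Qed.

Definition square_eval (b : g -> g -> g) (t : tensor (bar g) (bar g)) : g :=
  pair_eval b (tens_deriv (-1) D t).

Lemma square_eval_linear (b : {bilinear g -> g -> g}) : linear (square_eval b).
Proof.
apply: (linear_comp (pair_eval_linear b)).
exact: tens_deriv_linear (coder_linear cD).
Qed.

Lemma square_eval_bword (b : {bilinear g -> g -> g}) ws1 ws2 :
  square_eval b (tens (bword ws1) (bword ws2)) =
  b (phi (hvec (bword ws1))) (bproj (hvec (bword ws2))) +
  ksign K (hdeg (bword ws1)) *:
    b (bproj (hvec (bword ws1))) (phi (hvec (bword ws2))).
Proof. exact: pair_eval_deriv. Qed.

(** The coderivation identities move [D] inside the coproducts; the first minus is the sign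
    [(-1)^|D|] of the compatibility with [bar_ccop]. *)
Lemma phi_D x : phi (D x) =
  - (2^-1 *: square_eval lie (bar_ccop x)) - square_eval leib (bar_zcop x).
Proof.
rewrite phi_coproducts -(coder_ccop cD) -(coder_zcop cD).
rewrite (linZ (pair_eval_linear lie)) [ksign K (-1)](_ : _ = -1); last first.
  by rewrite /ksign exprN1 invrN1.
by rewrite scaleN1r scalerN.
Qed.

(* bproj and phi are concentrated on words of weights 1 and 2. *)
Lemma phi_D_wt ws : nonnil ws -> wt ws <> 3%N -> phi (D (hvec (bword ws))) = 0.
Proof.
move=> nn w3; rewrite phi_D.
have s0 (b : {bilinear g -> g -> g}) ws1 ws2 : (wt ws1 + wt ws2)%N = wt ws ->
    square_eval b (tens (bword ws1) (bword ws2)) = 0.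
  move=> wE; rewrite square_eval_bword.
  have [w1|w1] := eqVneq (wt ws1) 1%N.
    rewrite (phi_wt (ws := ws2)); last by lia.
    by rewrite (phi_wt (ws := ws1)) ?linear0l ?linear0r ?scaler0 ?addr0 //; lia.
  rewrite (bproj_wt (elimN eqP w1)) linear0l scaler0 addr0.
  have [w2|w2] := eqVneq (wt ws1) 2%N.
    by rewrite (bproj_wt (ws := ws2)) ?linear0r //; lia.
  by rewrite (phi_wt (elimN eqP w2)) linear0l.
rewrite (bar_ccop_wt0 (square_eval_linear lie) nn); last first.
  by move=> ws1 ws2 _ _ wE _; exact: s0.
rewrite (bar_zcop_wt0 (square_eval_linear leib) nn); last first.
  by move=> ws1 ws2 _ _ wE; exact: s0.
by rewrite scaler0 !oppr0 addr0.
Qed.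

Lemma hdeg_bword ws : hdeg (bword ws) = \sum_(w <- ws) (word_deg w + 1).
Proof. by rewrite hdeg_tword /word_deg big_map. Qed.

Definition hdeg_bwordE := (hdeg_bword, word_deg1, word_deg_cons, big_cons,
  big_nil, addr0).

(** A single letter has zero [bar_zcop]. Antisymmetry pairs the six terms of [bar_ccop] into the
    three brackets of the Jacobi identity, which absorbs the 1/2. *)
Lemma phi_D_jacobi a b c : phi (D (hvec (bword [:: [:: a; b; c]]))) =
  ksign K (hdeg b) *:
    (lie (base a) (lie (base b) (base c)) - lie (lie (base a) (base b)) (base c) -
     ksign K ((hdeg a - 1) * (hdeg b - 1)) *:
       lie (base b) (lie (base a) (base c))).
Proof.
rewrite phi_D.
have -> : square_eval leib (bar_zcop (hvec (bword [:: [:: a; b; c]]))) = 0.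
  rewrite -(lin0 (square_eval_linear leib)); congr (square_eval leib _).
  exact: zcop1.
have -> := @ccop_3 K (shift g) g _ (square_eval_linear lie) a b c.
rewrite !square_eval_bword !bproj_bword !phi_bword.
cbn beta iota.
rewrite !hdeg_bwordE ?(linear0l, linear0r, scaler0, addr0, add0r).
rewrite ?(linearZl_LR, linearZr_LR) subr0.
have ha := homog_base a; have hb := homog_base b; have hc := homog_base c.
rewrite (lie_swap hb (lie_deg ha hc)) (lie_swap ha (lie_deg hb hc)).
rewrite (lie_swap (lie_deg ha hb) hc).
have [p [[e1 e2 e3] _ pD pZ pN]] := combination3
  (lie (base a) (lie (base b) (base c))) (lie (lie (base a) (base b)) (base c))
  (lie (base b) (lie (base a) (base c))).
have n2 := two_neq0.
rewrite -e1 -e2 -e3 ?(pD, pZ, pN); congr p; by ksign_field a b c.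
Qed.

Lemma square_eval_zcop2 (br : {bilinear g -> g -> g}) w1 w2 :
  square_eval br (bar_zcop (hvec (bword [:: w1; w2]))) =
  square_eval br (tens (bword [:: w1]) (bword [:: w2])).
Proof. by congr (square_eval br _); exact: zcop2. Qed.

Lemma phi_D_leibniz a b c : phi (D (hvec (bword [:: [:: a]; [:: b]; [:: c]]))) =
  leib (leib (base a) (base b)) (base c) +
  ksign K (hdeg a - 1) *: leib (base a) (leib (base b) (base c)) +
  ksign K ((hdeg a - 1) * (hdeg b - 1) + (hdeg b - 1)) *:
    leib (base b) (leib (base a) (base c)).
Proof.
rewrite phi_D (bar_ccop_wt0 (square_eval_linear lie)) //; last first.
  (* No such pair exists: four nonempty letters cannot have total weight three. *)
  move=> ws1 ws2 /andP [_ n1] /andP [_ n2] wE sE.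
  have w3 : (wt ws1 + wt ws2 = 3)%N by rewrite wE.
  have s4 : (size ws1 + size ws2 = 4)%N by rewrite sE.
  by have := size_wt n1; have := size_wt n2; lia.
have -> := @zcop_111 K (shift g) g _ (square_eval_linear leib) a b c.
rewrite !square_eval_bword !bproj_bword !phi_bword.
cbn beta iota.
rewrite !hdeg_bwordE ?(linear0l, linear0r, scaler0, addr0, add0r).
rewrite ?(linearZl_LR, linearZr_LR, linearNl, linearNr).
rewrite oppr0 add0r.
have [p [[e1 e2 e3] _ pD pZ pN]] := combination3
  (leib (leib (base a) (base b)) (base c)) (leib (base a) (leib (base b) (base c)))
  (leib (base b) (leib (base a) (base c))).
have n2 := two_neq0.
rewrite -e1 -e2 -e3 ?(pD, pZ, pN); congr p; by ksign_field a b c.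
Qed.

(** The only term of [bar_zcop] gives the bracket of [lie a b] with [c]. The four terms of
    [bar_ccop] are two terms and their flips, equal in pairs by antisymmetry. *)
Lemma phi_D_lie_leib a b c : phi (D (hvec (bword [:: [:: a; b]; [:: c]]))) =
  ksign K (hdeg a) *: (lie (leib (base a) (base b)) (base c) -
    ksign K ((hdeg a - 1) * (hdeg b - 1)) *:
      lie (leib (base b) (base a)) (base c) -
    leib (lie (base a) (base b)) (base c)).
Proof.
rewrite phi_D square_eval_zcop2.
have -> := @ccop_21 K (shift g) g _ (square_eval_linear lie) a b c.
rewrite !square_eval_bword !bproj_bword !phi_bword.
cbn beta iota.
rewrite !hdeg_bwordE ?(linear0l, linear0r, scaler0, addr0, add0r).
rewrite ?(linearZl_LR, linearZr_LR, linearNl, linearNr).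
have ha := homog_base a; have hb := homog_base b; have hc := homog_base c.
rewrite (lie_swap (leib_deg ha hb) hc) (lie_swap (leib_deg hb ha) hc).
have [p [[e1 e2 e3] _ pD pZ pN]] := combination3
  (lie (leib (base a) (base b)) (base c)) (lie (leib (base b) (base a)) (base c))
  (leib (lie (base a) (base b)) (base c)).
have n2 := two_neq0.
rewrite -e1 -e2 -e3 ?(pD, pZ, pN); congr p; by ksign_field a b c.
Qed.

(** The only term of [bar_zcop] gives the bracket of [a] with [lie b c]; antisymmetry pairs the four
    terms of [bar_ccop] into the two on the other side of the identity. *)
Lemma phi_D_leib_lie a b c : phi (D (hvec (bword [:: [:: a]; [:: b; c]]))) =
  ksign K (hdeg a + hdeg b + 1) *: (lie (leib (base a) (base b)) (base c) +
    ksign K ((hdeg a - 1 + 1) * (hdeg b - 1)) *: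
      lie (base b) (leib (base a) (base c)) -
    leib (base a) (lie (base b) (base c))).
Proof.
rewrite phi_D square_eval_zcop2.
have -> := @ccop_12 K (shift g) g _ (square_eval_linear lie) a b c.
rewrite !square_eval_bword !bproj_bword !phi_bword.
cbn beta iota.
rewrite !hdeg_bwordE ?(linear0l, linear0r, scaler0, addr0, add0r).
rewrite ?(linearZl_LR, linearZr_LR, linearNl, linearNr).
have ha := homog_base a; have hb := homog_base b; have hc := homog_base c.
rewrite (lie_swap (leib_deg ha hb) hc) (lie_swap hb (leib_deg ha hc)).
have [p [[e1 e2 e3] _ pD pZ pN]] := combination3
  (lie (leib (base a) (base b)) (base c)) (lie (base b) (leib (base a) (base c)))
  (leib (base a) (lie (base b) (base c))).
have n2 := two_neq0.
rewrite -e1 -e2 -e3 ?(pD, pZ, pN); congr p; by ksign_field a b c.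
Qed.

(** On the four kinds of words of weight three [phi (D x)] is, up to an invertible sign, the defect
    of one of the four identities, and every homogeneous triple of [g] occurs as letters. *)
Lemma Lie_Leibniz_phi_D :
  Lie_Leibniz_algebra lie leib <-> forall x, phi (D x) = 0.
Proof.
(* The letter records the degree [i + 1] even if [x] is zero, so the signs come out for the
   prescribed degrees. *)
have to_base i (x : g) : homog i x ->
    exists2 a : helt (shift g), base a = x & hdeg a = i + 1.
  move=> /eqP hx; exists (hcomp (i + 1) (sh x)) => //.
  by rewrite /base hvec_hcomp /gproj /= /shift_proj /= addrK.
split=> [[_ _ jacobi _ leibniz ll1 ll2]|phi0].
  apply: bar_eq0; first exact: linear_comp phi_linear (coder_linear cD).
  move=> ws /andP [_ nn]; have [w3|/eqP w3] := eqVneq (wt ws) 3%N; last first.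
    exact: phi_D_wt.
  case: (wt_eq3 nn w3) => -[a [b [c ->]]];
    have ha := homog_base a; have hb := homog_base b; have hc := homog_base c.
  - rewrite phi_D_jacobi (jacobi _ _ _ _ _ _ ha hb hc).
    by rewrite addrAC addrK subrr scaler0.
  - rewrite phi_D_lie_leib (ll2 _ _ _ _ _ _ ha hb hc).
    by rewrite subrr scaler0.
  - rewrite phi_D_leib_lie (ll1 _ _ _ _ _ _ ha hb hc).
    by rewrite subrr scaler0.
  - rewrite phi_D_leibniz -[RHS](leibniz _ _ _ _ _ _ ha hb hc).
    by rewrite [X in X + _ = _]addrC.
have scale_eq0 n (x : g) : ksign K n *: x = 0 -> x = 0.
  by move=> /eqP; rewrite scaler_eq0 (negPf (ksign_neq0 K n)) => /eqP.
split=> // i j k x y z /to_base [a <- ai] /to_base [b <- bj] /to_base [c <- _].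
- have := phi0 (hvec (bword [:: [:: a; b; c]])).
  rewrite phi_D_jacobi ai bj !addrK => /scale_eq0/eqP.
  by rewrite -addrA -opprD subr_eq0 => /eqP.
- have := phi0 (hvec (bword [:: [:: a]; [:: b]; [:: c]])).
  by rewrite phi_D_leibniz ai bj !addrK => <-; rewrite [X in X + _ = _]addrC.
- have := phi0 (hvec (bword [:: [:: a]; [:: b; c]])).
  rewrite phi_D_leib_lie ai bj !addrK => /scale_eq0/eqP.
  by rewrite subr_eq0 => /eqP.
- have := phi0 (hvec (bword [:: [:: a; b]; [:: c]])).
  rewrite phi_D_lie_leib ai bj !addrK => /scale_eq0/eqP.
  by rewrite subr_eq0 => /eqP.
Qed.

End Square.

End Bracket.

Theorem proposition5p14 (K : fieldType) (charK : [pchar K] =i pred0)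
    (g : gradedLmodType K) (lie leib : {bilinear g -> g -> g})
    (lie_deg : bracket_degree 0 lie) (lie_anti : graded_antisymmetric lie)
    (leib_deg : bracket_degree 1 leib)
    (dLie dLeib : bar g -> bar g)
    (dLie_ind : induced_coderivation (-1) (lie_corestriction lie) dLie)
    (dLeib_ind : induced_coderivation (-1) (leib_corestriction leib) dLeib) :
  Lie_Leibniz_algebra lie leib <-> codifferential (-1) (dLie \+ dLeib).
Proof.
have [cLie pLie] := dLie_ind; have [cLeib pLeib] := dLeib_ind.
have cD := coderivation_add cLie cLeib.
have bproj_D x : bproj ((dLie \+ dLeib) x) = phi lie leib x.
  rewrite /phi -pLie -pLeib [(_ \+ _) x]/= (linD (@bproj_linear K g)).
  by rewrite /bproj.
rewrite (Lie_Leibniz_phi_D charK lie_deg lie_anti leib_deg cD bproj_D).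
split=> [phi0|[_ DD0] x]; last by rewrite -bproj_D DD0 (lin0 (@bproj_linear K g)).
split=> //; apply: (coder_square_eq0 charK cD) => x.
(* [bproj] only strips the two suspensions from [bar_proj], so its vanishing passes back to
   [bar_proj]. *)
have := phi0 x; rewrite -bproj_D /bproj.
by case: (bar_proj _) => -[v] /= ->.
Qed.
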